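(* Let $q\in(1,2]$ and let $\mathcal{G}:L^q(\Omega)\to[0,\infty]$ be the generative prior (defined in the context), where $Z:\Theta\to\mathbb{R}^{N_c}$ is linear and bounded and the functionals $\mathcal{J}_l:M^l\to[0,\infty]$ are weak* lower semicontinuous with $\mathcal{J}_l(0)=0$. Then $\mathcal{G}$ is weakly lower semicontinuous, i.e. $v_m\rightharpoonup v$ in $L^q(\Omega)$ implies $\mathcal{G}(v)\le\liminf_{m\to\infty}\mathcal{G}(v_m)$.
   Context: Domains and measures. $\Omega,\Sigma\subset\mathbb{R}^d$ are bounded domains, i.e. bounded, open and simply connected sets, with $0\in\Sigma$. For sets, $A-B=\{x-y: x\in A,\ y\in B\}$. Put $\Omega^0=\Omega$, $\Omega^1=\Omega-\Sigma$ and $\Omega^{l+1}=\Omega^l-\Sigma$. For $\omega\subset\mathbb{R}^d$, $C_0(\omega)$ is the closure of $C_c(\omega)$ in the uniform norm, and $(\mathcal{M}(\omega),\|\cdot\|_{\mathcal M})$ is its dual space (finite Radon measures with the total variation norm). For bounded $\omega$, a function $f\in L^q(\omega)$ is identified with the element $\phi\mapsto\int_\omega f\phi\,dx$ of $\mathcal{M}(\omega)$; $\|\cdot\|_2$ is the $L^2$-norm. Convolution. For $l\ge1$, $\mu\in\mathcal{M}(\Omega^l)$ and $g\in L^2(\Sigma)$, $\mu*g$ denotes the unique function, belonging to $L^q(\Omega^{l-1})$ for every $q\in(1,2]$, with $\int_{\Omega^{l-1}}(\mu*g)\phi\,dx=\int_{\Omega^l}\int_\Sigma\tilde\phi(x+y)g(x)\,dx\,d\mu(y)$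 for all $\phi\in C_c(\Omega^{l-1})$, where $\tilde\phi$ is the extension of $\phi$ by zero to $\mathbb{R}^d$. (It is known that such a function exists and that $\|\mu*g\|_q\le C\|\mu\|_{\mathcal M}\|g\|_2$ with a constant $C$ independent of $\mu,g$.) Network. Let $L\in\mathbb{N}$ be the number of layers, $N_1,\dots,N_L\in\mathbb{N}$ and $N_0=1$. For $l=1,\dots,L$ let $E^l\subset\{1,\dots,N_l\}\times\{1,\dots,N_{l-1}\}$ be such that for each $n\in\{1,\dots,N_l\}$ there is some $k$ with $(n,k)\in E^l$. Set $M^l=\mathcal{M}(\Omega^l)^{N_l}$, $M=M^1\times\dots\times M^L$, $\Theta^l=L^2(\Sigma)^{|E^l|}$ with elements $\theta^l=(\theta^l_{n,k})_{(n,k)\in E^l}$, and $\Theta=\Theta^1\times\dots\times\Theta^L$. Define $\mu^1*_1\theta^1=\sum_{n=1}^{N_1}\mu^1_n*\theta^1_{n,1}\in L^q(\Omega)$ and, for $l=2,\dots,L$, $\mu^l*_l\theta^l=\big(\sum_{n:(n,k)\in E^l}\mu^l_n*\theta^l_{n,k}\big)_{k=1}^{N_{l-1}}\in M^{l-1}$. Generative prior. With $Z$ ($N_c\in\mathbb{N}$) and $\mathcal{J}_l$, $l=1,\dots,L-1$, as in the claim, put $\|\mu\|_{\mathcal M}=\sum_{l=1}^L\sum_{n=1}^{N_l}\|\mu^l_n\|_{\mathcal M}$ and $G(\mu,\theta)=\|\mu\|_{\mathcal M}+\sum_{l=2}^L\mathcal{J}_{l-1}(\mu^{l-1}-\mu^l*_l\theta^l)$.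 For $v\in L^q(\Omega)$ let $F(v)$ be the set of all $(\mu,\theta)\in M\times\Theta$ with $v=\mu^1*_1\theta^1$, $\|\theta^l_{n,k}\|_2\le1$ for all $l$ and all $(n,k)\in E^l$, and $Z\theta=0$. Then $\mathcal{G}(v)=\inf_{(\mu,\theta)\in F(v)}G(\mu,\theta)$, with $\mathcal{G}(v)=\infty$ if $F(v)=\emptyset$. *)

(* Defs.v *)
From HB Require Import structures.
From mathcomp Require Import all_boot all_order all_algebra.
From mathcomp Require Import all_classical all_reals all_analysis.
From mathcomp Require Import measurable_realfun ring lra.

Set Implicit Arguments.
Unset Strict Implicit.
Unset Printing Implicit Defensive.

Import Order.TTheory GRing.Theory Num.Theory.
Import numFieldNormedType.Exports.

Local Open Scope classical_set_scope.
Local Open Scope ring_scope.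

Definition borel_mx_display : measure_display. Proof. exact. Qed.

Section borel_mx.
Context (R : realType) (m n : nat).

Let borel_mx : set (set 'M[R]_(m, n)) := <<s @open 'M[R]_(m, n) >>.

HB.instance Definition _ := @isMeasurable.Build borel_mx_display 'M[R]_(m, n)
  borel_mx (@sigma_algebra0 _ setT _) (@sigma_algebraC _ _)
  (@sigma_algebra_bigcup _ setT _).

End borel_mx.

Section rV_measurable.
Context (R : realType) (d : nat).

Lemma open_measurable_rV (A : set 'rV[R]_d) : open A -> measurable A.
Proof. exact: sub_sigma_algebra. Qed.

Lemma measurable_coord (i : 'I_d) :
  measurable_fun setT (fun x : 'rV[R]_d => x ord0 i).
Proof.
apply: (measurability _ (RGenOpens.measurableE R)).
move=> _ [_ [a [b ->]] <-]; rewrite setTI; apply: open_measurable_rV.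
apply: open_comp; last exact: interval_open.
by move=> x _; exact: coord_continuous.
Qed.

Definition ratball (q : 'rV[rat]_d * rat) : set 'rV[R]_d :=
  ball (map_mx ratr q.1 : 'rV[R]_d) (ratr q.2).

Lemma open_ratballE (U : set 'rV[R]_d) : open U ->
  U = \bigcup_(q in [set q | ratball q `<=` U]) ratball q.
Proof.
move=> oU; apply/seteqP; split=> [x Ux|x [q qU]]; last exact: qU.
have /nbhs_ballP[e /= e0 xeU] : nbhs x U by exact: open_nbhs_nbhs.
have [r /[!in_itv]/= /andP[r0 re]] : exists r, ratr r \in `]0, e / 2[.
  by apply: rat_in_itvoo; rewrite divr_gt0.
have c_ i : {c : rat | ratr c \in `]x ord0 i - ratr r, x ord0 i + ratr r[}.
  by apply/cid/rat_in_itvoo; rewrite ltrD2l gt0_cp.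
pose c : 'rV[rat]_d := \row_i sval (c_ i).
have xc : ball x (ratr r) (map_mx ratr c : 'rV[R]_d).
  split => // i j; rewrite ord1 !mxE /ball /= ltr_distlC.
  by case: (c_ j) => /= s; rewrite in_itv.
exists (c, r); last exact: ball_sym.
move=> y /= cry; apply: xeU.
apply: (@le_ball _ _ _ (ratr r + ratr r)); last exact: ball_triangle xc cry.
by rewrite [leRHS]splitr lerD// ltW.
Qed.

Lemma measurable_fun_rV d' (T : measurableType d') (f : T -> 'rV[R]_d) :
  (forall i, measurable_fun setT (fun x => f x ord0 i)) ->
  measurable_fun setT f.
Proof.
move=> mf; apply: (@measurability _ _ _ _ _ _ (@open 'rV[R]_d) erefl).
move=> _ [U oU <-]; rewrite setTI (open_ratballE oU) preimage_bigcup.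
rewrite bigcup_mkcond; apply: countable_bigcupT_measurable.
  exact: countableP.
move=> [c r]; case: ifPn => // _.
have [r0|r0] := leP (ratr r : R) 0.
  rewrite (_ : _ @^-1` _ = set0)// -subset0 => x []/=.
  by rewrite ltNge r0.
rewrite (_ : _ @^-1` _ = \bigcap_(i in [set: 'I_d])
   (setT `&` (fun x => f x ord0 i) @^-1` ball (ratr (c ord0 i) : R) (ratr r))).
  apply: fin_bigcap_measurable => [|i _]; first exact: finite_finset.
  by apply: mf => //; apply: open_measurable; exact: ball_open.
apply/seteqP; split=> [x [_ fx] i _|x fx].
  by split => //; have := fx ord0 i; rewrite !mxE.
by split => // i j; rewrite ord1 !mxE; have [] := fx j I.
Qed.

End rV_measurable.

Section lebesgue_rV.
Context (R : realType).

Definition cons_rV d (p : measurableTypeR R * 'rV[R]_d) : 'rV[R]_d.+1 :=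
  row_mx (const_mx p.1 : 'rV[R]_1) p.2.

Definition uncons_rV d (x : 'rV[R]_d.+1) : measurableTypeR R * 'rV[R]_d :=
  (x ord0 ord0, rsubmx (x : 'rV[R]_(1 + d))).

Lemma cons_rVK d : cancel (@cons_rV d) (@uncons_rV d).
Proof.
case=> a v; rewrite /uncons_rV /cons_rV row_mxKr; congr pair.
have -> : (ord0 : 'I_d.+1) = lshift d (ord0 : 'I_1) by exact: val_inj.
by apply: etrans (row_mxEl _ _ _ _) _; rewrite mxE.
Qed.

Lemma uncons_rVK d : cancel (@uncons_rV d) (@cons_rV d).
Proof.
move=> x; apply: etrans (@hsubmxK _ 1 1 d x); rewrite /cons_rV /=.
congr (row_mx _ _); apply/rowP => i; rewrite !mxE; congr (x _ _).
by apply: val_inj; rewrite (ord1 i).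
Qed.

Lemma measurable_cons_rV d : measurable_fun setT (@cons_rV d).
Proof.
apply: measurable_fun_rV => i.
rewrite /cons_rV; case: (@split_ordP 1 d i) => j ->.
  rewrite [X in measurable_fun _ X](_ : _ = fst); first exact: measurable_fst.
  by apply/funext => x; apply: etrans (row_mxEl _ _ _ _) _; rewrite mxE.
rewrite [X in measurable_fun _ X](_ : _ = (fun v : 'rV[R]_d => v ord0 j) \o snd).
  exact: (measurableT_comp (measurable_coord j) measurable_snd).
by apply/funext => x; apply: etrans (row_mxEr _ _ _ _) _.
Qed.

Lemma measurable_uncons_rV d : measurable_fun setT (@uncons_rV d).
Proof.
apply/measurable_fun_pairP; split; first exact: measurable_coord.
apply: measurable_fun_rV => i.
by under eq_fun do rewrite /= mxE; exact: measurable_coord.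
Qed.

Lemma prod_sigma_finite d1 d2 (T1 : measurableType d1) (T2 : measurableType d2)
    (m1 : {sigma_finite_measure set T1 -> \bar R})
    (m2 : {sigma_finite_measure set T2 -> \bar R}) :
  sigma_finite setT (m1 \x m2)%E.
Proof.
have /sigma_finiteP[F [TF ndF Foo]] := sigma_finiteT m1.
have /sigma_finiteP[G [TG ndG Goo]] := sigma_finiteT m2.
exists (fun n => F n `*` G n).
  rewrite -setXTT TF TG predeqE => -[x y]; split.
    move=> [/= [n _ Fnx] [k _ Gky]]; exists (maxn n k) => //; split.
    - by move: x Fnx; exact/subsetPset/ndF/leq_maxl.
    - by move: y Gky; exact/subsetPset/ndG/leq_maxr.
  by move=> [n _ []/= ? ?]; split; exists n.
move=> k; have [? ?] := Foo k; have [? ?] := Goo k.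
split; first exact: measurableX.
by rewrite product_measure1E// lte_mul_pinfty// ge0_fin_numE.
Qed.

Section step.
Context (d : nat) (nu : {sigma_finite_measure set 'rV[R]_d -> \bar R}).

Definition leb_step (A : set 'rV[R]_d.+1) : \bar R :=
  pushforward (@lebesgue_measure R \x nu)%E (@cons_rV d) A.

Let leb_step0 : leb_step set0 = 0%E.
Proof. by rewrite /leb_step /pushforward preimage_set0 measure0. Qed.

Let leb_step_ge0 A : (0 <= leb_step A)%E.
Proof. by rewrite /leb_step /pushforward measure_ge0. Qed.

Let leb_step_sigma_additive : semi_sigma_additive leb_step.
Proof.
have mcons A : measurable A -> measurable (@cons_rV d @^-1` A).
  by move=> mA; rewrite -[X in measurable X]setTI; exact: measurable_cons_rV.
move=> F mF tF mUF; rewrite /leb_step /pushforward preimage_bigcup.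
apply: measure_semi_sigma_additive => [n||].
- exact: mcons.
- apply/trivIsetP => i j _ _ ij; rewrite -preimage_setI.
  by move/trivIsetP : tF => /(_ _ _ I I ij) ->; rewrite preimage_set0.
- by rewrite -preimage_bigcup; exact: mcons.
Qed.

HB.instance Definition _ := isMeasure.Build _ _ _ leb_step
  leb_step0 leb_step_ge0 leb_step_sigma_additive.

Let leb_step_sigma_finite : sigma_finite setT leb_step.
Proof.
have [F TF Foo] :=
  prod_sigma_finite (@lebesgue_measure R) nu.
exists (fun n => @uncons_rV d @^-1` F n).
  by rewrite -preimage_bigcup -TF preimage_setT.
move=> n; have [mF Fn] := Foo n; split.
  by rewrite -[X in measurable X]setTI; exact: measurable_uncons_rV.
rewrite /leb_step /pushforward -comp_preimage.
by rewrite (_ : _ \o _ = id) ?preimage_id//; apply/funext => x /=; rewrite cons_rVK.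
Qed.

HB.instance Definition _ :=
  Measure_isSigmaFinite.Build _ _ _ leb_step leb_step_sigma_finite.

End step.

Fixpoint lebesgue_rV d : {sigma_finite_measure set 'rV[R]_d -> \bar R} :=
  match d with
  | 0 => dirac (0 : 'rV[R]_0)
  | d'.+1 => leb_step (lebesgue_rV d')
  end.

End lebesgue_rV.

Section opensets.
Context (R : realType) (d : nat).

Record openset := Openset {
  oset :> set 'rV[R]_d;
  oset_open : open oset }.
Arguments oset_open : clear implicits.

Definition setsub (A B : set 'rV[R]_d) : set 'rV[R]_d :=
  [set x - y | x in A & y in B].

Lemma open_setsub (A B : set 'rV[R]_d) : open A -> open (setsub A B).
Proof.
move=> oA; rewrite openE => _ [a Aa [b Bb <-]].
have /nbhs_ballP[e /= e0 aeA] : nbhs a A by exact: open_nbhs_nbhs.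
apply/nbhs_ballP; exists e => //= z; rewrite -ball_normE /= => abz.
exists (z + b); last by exists b => //; rewrite addrK.
by apply: aeA; rewrite -ball_normE /= opprD addrA addrAC.
Qed.

Definition osetsub (A B : openset) : openset :=
  Openset (open_setsub (B := B) (oset_open A)).

Fixpoint Omegas (Omega Sigma : openset) (l : nat) : openset :=
  if l is l'.+1 then osetsub (Omegas Omega Sigma l') Sigma else Omega.

Definition leb_on (w : openset) : {measure set 'rV[R]_d -> \bar R} :=
  mrestr (lebesgue_rV R d) (open_measurable_rV (oset_open w)).

Definition path_connected (A : set 'rV[R]_d) :=
  A !=set0 /\ forall x y, A x -> A y ->
    exists g : R -> 'rV[R]_d, [/\ {within `[0, 1], continuous g},
      g 0 = x, g 1 = y & forall t, t \in `[0, 1] -> A (g t)].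

(* [H s t] contracts the loop [g] to its base point inside [A] as [t] goes
   from 0 to 1, the base point being kept fixed. *)
Definition simply_connected (A : set 'rV[R]_d) :=
  path_connected A /\
  forall g : R -> 'rV[R]_d, {within `[0, 1], continuous g} ->
    g 0 = g 1 -> (forall t, t \in `[0, 1] -> A (g t)) ->
  exists H : R * R -> 'rV[R]_d,
    [/\ {within `[0, 1] `*` `[0, 1], continuous H},
        forall s, s \in `[0, 1] -> H (s, 0) = g s /\ H (s, 1) = g 0,
        forall t, t \in `[0, 1] -> H (0, t) = g 0 /\ H (1, t) = g 0 &
        forall s t, s \in `[0, 1] -> t \in `[0, 1] -> A (H (s, t))].

End opensets.

Section C0.
Context (R : realType) (d : nat).
Implicit Types (f g : 'rV[R]_d -> R).

(* Elements of C_c(w) and C_0(w), for [w] open, are represented by their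
   extension by zero to R^d. *)
Definition Cc (w : set 'rV[R]_d) : set ('rV[R]_d -> R) :=
  [set f | [/\ continuous f, compact (closure [set x | f x != 0]) &
               closure [set x | f x != 0] `<=` w]].

Definition C0_pred (w : set 'rV[R]_d) : {pred 'rV[R]_d -> R} :=
  fun f => `[< forall e, 0 < e ->
    exists2 g, Cc w g & forall x, `|f x - g x| <= e >].

Lemma Cc0 w : Cc w (fun=> 0).
Proof.
split; first exact: cst_continuous.
- rewrite (_ : [set _ | _] = set0) ?closure0; first exact: compact0.
  by rewrite -subset0 => x /=; rewrite eqxx.
- rewrite (_ : [set _ | _] = set0) ?closure0//.
  by rewrite -subset0 => x /=; rewrite eqxx.
Qed.

Lemma Cc_lin w a f g : Cc w f -> Cc w g -> Cc w (fun x => a * f x + g x).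
Proof.
move=> [cf kf sf] [cg kg sg].
have sub : closure [set x | a * f x + g x != 0] `<=`
    closure [set x | f x != 0] `|` closure [set x | g x != 0].
  rewrite -closureU; apply: closureS => x /= afg.
  have [fx0|fx0] := eqVneq (f x) 0; last by left.
  by right; move: afg; rewrite fx0 mulr0 add0r.
split.
- by move=> x; exact: (cvgD (cvgM (cvg_cst a) (cf x)) (cg x)).
- apply: (subclosed_compact (@closed_closure _ _) _ sub).
  exact: compactU.
- by apply: (subset_trans sub); rewrite subUset.
Qed.

Variable w : set 'rV[R]_d.

Record C0 := MkC0 { C0_fun :> 'rV[R]_d -> R; C0_funP : C0_fun \in C0_pred w }.

HB.instance Definition _ := [isSub for C0_fun].
HB.instance Definition _ := [Choice of C0 by <:].

Lemma C0_submod_closed : submod_closed (C0_pred w).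
Proof.
split.
  apply/asboolP => e e0; exists (fun=> 0); first exact: Cc0.
  by move=> x; rewrite subrr normr0 ltW.
move=> a f g /asboolP cf /asboolP cg; apply/asboolP => e e0.
have a1 : 0 < `|a| + 1 by rewrite ltr_wpDl.
have e2 : 0 < e / 2 by rewrite divr_gt0.
have [f' cf' ff'] := cf (e / 2 / (`|a| + 1)) (divr_gt0 e2 a1).
have [g' cg' gg'] := cg (e / 2) e2.
exists (fun x => a * f' x + g' x); first exact: Cc_lin.
move=> x; rewrite (_ : _ - _ = a * (f x - f' x) + (g x - g' x)); last first.
  by rewrite /= mulrBr opprD addrACA.
rewrite (le_trans (ler_normD _ _))// [leRHS]splitr lerD// normrM.
rewrite (le_trans (ler_wpM2l _ (ff' x)))// mulrCA.
rewrite ler_piMr ?divr_ge0 ?(ltW e0)// ler_pdivrMr// mul1r.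
by rewrite lerDl.
Qed.

HB.instance Definition _ := GRing.isSubmodClosed.Build R _ (C0_pred w)
  C0_submod_closed.
HB.instance Definition _ := [SubChoice_isSubLmodule of C0 by <:].

Lemma C0_bounded (f : C0) : exists M, forall x, `|f x| <= M.
Proof.
have /asboolP/(_ 1 ltr01)[g [cg kg _] fg] := C0_funP f.
have [M [_ Mg]] := compact_bounded (continuous_compact
  (continuous_subspaceT cg) kg).
exists (1 + `|M| + 1) => x.
rewrite -(subrK (g x) (f x)) (le_trans (ler_normD _ _))// -addrA lerD//.
have [gx0|gx0] := eqVneq (g x) 0; first by rewrite gx0 normr0 addr_ge0.
apply: Mg; first by rewrite (le_lt_trans (ler_norm _))// ltrDl.
by exists x => //; exact: subset_closure.
Qed.

Definition C0_norm (f : C0) : R := sup [set `|f x| | x in setT].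

Let C0_has_sup (f : C0) : has_sup [set `|f x| | x in setT].
Proof.
split; first by exists `|f 0|, 0.
by have [M fM] := C0_bounded f; exists M => _ [x _ <-].
Qed.

Lemma C0_norm_ub (f : C0) x : `|f x| <= C0_norm f.
Proof. by apply: sup_upper_bound; [exact: C0_has_sup|exists x]. Qed.

Lemma C0_norm_le (f : C0) M : (forall x, `|f x| <= M) -> C0_norm f <= M.
Proof.
by move=> fM; apply: ge_sup; [exact: (C0_has_sup f).1|move=> _ [x _ <-]].
Qed.

Let C0_normD (f g : C0) : C0_norm (f + g) <= C0_norm f + C0_norm g.
Proof.
apply: C0_norm_le => x; rewrite (le_trans (ler_normD _ _))//.
by rewrite lerD// C0_norm_ub.
Qed.

Let C0_normZ (a : R) (f : C0) : C0_norm (a *: f) = `|a| * C0_norm f.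
Proof.
have le_Z (b : R) (h : C0) : C0_norm (b *: h) <= `|b| * C0_norm h.
  by apply: C0_norm_le => x; rewrite normrM ler_wpM2l// C0_norm_ub.
apply/eqP; rewrite eq_le le_Z/=.
have [->|a0] := eqVneq a 0.
  by rewrite normr0 mul0r (le_trans _ (C0_norm_ub _ 0)).
rewrite -ler_pdivlMl ?normr_gt0// -normfV.
by rewrite (le_trans _ (le_Z _ _))// scalerA mulVf// scale1r.
Qed.

Let C0_norm_eq0 (f : C0) : C0_norm f = 0 -> f = 0.
Proof.
move=> f0; apply/val_inj/funext => x; apply/eqP.
by rewrite -normr_le0 -f0 C0_norm_ub.
Qed.

HB.instance Definition _ :=
  @Lmodule_isNormed.Build R C0 C0_norm C0_normD C0_normZ C0_norm_eq0.

End C0.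

Section dual.
Context (R : realType) (V : normedModType R).

Definition dual_pred : {pred V -> R} :=
  fun u => `[< linear_for *%R u /\ continuous u >].

Record dual := MkDual { dual_fun :> V -> R; dual_funP : dual_fun \in dual_pred }.

HB.instance Definition _ := [isSub for dual_fun].
HB.instance Definition _ := [Choice of dual by <:].

Lemma dual_submod_closed : submod_closed dual_pred.
Proof.
split.
  apply/asboolP; split; last exact: cst_continuous.
  by move=> a x y; rewrite mulr0 addr0.
move=> a u v /asboolP[lu cu] /asboolP[lv cv]; apply/asboolP; split.
  move=> b x y /=.
  rewrite [LHS]/(a * u (b *: x + y) + v (b *: x + y)) lu lv.
  by rewrite !mulrDr (mulrCA a) addrACA.
by move=> x; exact: (cvgD (cvgM (cvg_cst a) (cu x)) (cv x)).
Qed.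

HB.instance Definition _ := GRing.isSubmodClosed.Build R _ dual_pred
  dual_submod_closed.
HB.instance Definition _ := [SubChoice_isSubLmodule of dual by <:].

Definition dual_norm (u : dual) : \bar R :=
  ereal_sup [set `|u x|%:E | x in [set x : V | `|x| <= 1]].

End dual.

Section convolution.
Context (R : realType) (d : nat).
Implicit Types (w : openset R d) (h : 'rV[R]_d -> R).

Definition M w := dual (C0 (R := R) w).

(* The measure [h dx]; the default value 0 is only taken when the functional is
   not continuous, which does not happen for integrable [h], see [densE]. *)
Definition dens w h : M w :=
  insubd (0 : M w) (fun phi : C0 w => \int[leb_on w]_x (h x * phi x)).

Lemma C0_continuous w (phi : C0 w) : continuous phi.
Proof.
move=> x; apply/(@cvgrPdist_le _ _ _ (nbhs x)) => e e0.
have e3 : 0 < e / 3 by rewrite divr_gt0.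
have /asboolP/(_ _ e3)[g [cg _ _] phig] := C0_funP phi.
near=> y.
have gxy : `|g x - g y| <= e / 3.
  by near: y; move/(@cvgrPdist_le _ _ _ (nbhs x)) : (cg x); exact.
rewrite (_ : phi x - phi y = (phi x - g x) + (g x - g y) + - (phi y - g y)).
  rewrite (le_trans (ler_normD _ _))// normrN.
  rewrite (_ : e = e / 3 + e / 3 + e / 3); last by field.
  by rewrite lerD// (le_trans (ler_normD _ _))// lerD.
by ring.
Unshelve. all: by end_near. Qed.

Lemma C0_measurable w (phi : C0 w) : measurable_fun setT phi.
Proof.
apply: (measurability _ (RGenOpens.measurableE R)).
move=> _ [_ [a [b ->]] <-]; rewrite setTI; apply: open_measurable_rV.
apply: open_comp; last exact: interval_open.
by move=> x _; exact: C0_continuous.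
Qed.

Lemma integrable_C0 w h (phi : C0 w) : h \in Lfun (leb_on w) 1 ->
  (leb_on w).-integrable setT (EFin \o (fun x => h x * phi x)).
Proof.
move=> /Lfun1_integrable ih; have [B phiB] := C0_bounded phi.
apply: (integrableMl measurableT ih (C0_measurable phi)).
exists B; split; first exact: num_real.
by move=> y By x _; exact: le_trans (phiB x) (ltW By).
Qed.

Lemma densE w h (phi : C0 w) : h \in Lfun (leb_on w) 1 ->
  dens w h phi = \int[leb_on w]_x (h x * phi x).
Proof.
move=> Lh; rewrite /dens val_insubd ifT//; apply/asboolP.
set F := (fun phi : C0 w => _).
have lF : linear_for *%R F.
  move=> a f g; rewrite /F -RintegralZl//; last exact: integrable_C0.
  rewrite -RintegralD//.
  - by apply: eq_Rintegral => x _ /=; rewrite mulrDr mulrCA.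
  - rewrite (_ : _ \o _ = EFin \o (fun x => h x * (a *: f) x)).
      exact: integrable_C0.
    by apply/funext => x /=; rewrite mulrCA.
  - exact: integrable_C0.
split=> // f; pose C := \int[leb_on w]_x `|h x|.
have ih : (leb_on w).-integrable setT (EFin \o (fun x => `|h x|)).
  by apply/Lfun1_integrable; exact: Lfun_norm.
have C0 : 0 <= C by exact: Rintegral_ge0.
have FC g : `|F g| <= C * `|g|.
  have ihg := integrable_C0 g Lh.
  rewrite (le_trans (le_normr_Rintegral _ _))// -RintegralZr//.
  apply: le_Rintegral => //.
  - by apply/Lfun1_integrable/Lfun_norm/Lfun1_integrable.
  - rewrite (_ : _ \o _ = (fun x => (`|h x|%:E * `|g|%:E)%E))//.
    exact: integrableZr.
  - by move=> x _; rewrite normrM ler_wpM2l// C0_norm_ub.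
apply/(@cvgrPdist_lt _ _ _ (nbhs f)) => e e0; near=> g.
have -> : F f - F g = F (f - g).
  by rewrite addrC -mulN1r -lF scaleN1r addrC.
rewrite (le_lt_trans (FC _))//.
have : `|f - g| < e / (C + 1).
  by near: g; apply: cvgr_dist_lt => //; rewrite divr_gt0// ltr_wpDl.
rewrite ltr_pdivlMr ?ltr_wpDl//; apply: le_lt_trans.
by rewrite mulrC ler_wpM2l// lerDl.
Unshelve. all: by end_near. Qed.

(* The inner integral is a function of [y] lying in C_0(w') when
   [w' = w - Sigma]; [mu psi] is its integral against [mu]. *)
Definition is_conv w w' (Sigma : openset R d) (mu : M w') (g h : 'rV[R]_d -> R)
    : Prop :=
  (forall q : R, 1 < q <= 2 -> h \in Lfun (leb_on w) q%:E) /\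
  forall phi, Cc w phi ->
    exists2 psi : C0 w',
      forall y, oset w' y ->
        psi y = \int[leb_on Sigma]_x (phi (x + y) * g x) &
      \int[leb_on w]_x (h x * phi x) = mu psi.

(* Such an [h] exists when [w' = w - Sigma] is bounded and [g] is square
   integrable, and is unique up to equality almost everywhere on [w]. *)
Definition conv w w' (Sigma : openset R d) (mu : M w') (g : 'rV[R]_d -> R) :
    'rV[R]_d -> R :=
  xget (fun=> 0) [set h | is_conv w Sigma mu g h].

End convolution.

Section Lebesgue_spaces.
Context (R : realType) (d : nat) (w : openset R d).

Lemma expo_ge1 (q : R) : 1 < q <= 2 -> (1 <= q%:E)%E.
Proof. by move=> /andP[/ltW]; rewrite lee_fin. Qed.

Lemma expo2 : 1 < (2 : R) <= 2.
Proof. by rewrite ltr1n lexx. Qed.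

(* Elements are functions; those equal almost everywhere on [w] are not
   identified. *)
Definition Lq (q : R) (hq : 1 < q <= 2) := LfunType (leb_on w) (expo_ge1 hq).
HB.instance Definition _ q (hq : 1 < q <= 2) := GRing.Lmodule.on (Lq hq).

Definition Lq_norm (q : R) (h : 'rV[R]_d -> R) : R :=
  fine ('N[leb_on w]_(q%:E) [EFin \o h]).

Definition weak_cvg (q : R) (hq : 1 < q <= 2) (v_ : nat -> Lq hq) (v : Lq hq) :=
  forall ell : {scalar Lq hq},
    (exists C, forall f, `|ell f| <= C * Lq_norm q f) ->
    (fun m => ell (v_ m)) @ \oo --> ell v.

End Lebesgue_spaces.

(* For [0 < l], [width l] is the number of channels of the [l]-th layer.
   [edges l] links the channels of layer [l + 1] to those of layer [l], so that
   an index [l : 'I_(nlayers net)] below stands for layer [l + 1]. *)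
Record network := Network {
  nlayers : nat;
  nlayers_gt0 : (0 < nlayers)%N;
  width : nat -> nat;
  width0 : width 0 = 1%N;
  edges : forall l, {set 'I_(width l.+1) * 'I_(width l)};
  edges_total : forall l, (l < nlayers)%N ->
    forall n, exists k, (n, k) \in edges l }.

Section prior.
Context (R : realType) (d : nat) (Omega Sigma : openset R d) (net : network).
Local Notation L := (nlayers net).
Local Notation N := (width net).
Local Notation Om := (Omegas Omega Sigma).

Definition edge (l : nat) := {e : 'I_(N l.+1) * 'I_(N l) | e \in edges net l}.

Definition Mlayer (l : nat) := 'I_(N l) -> M (Om l).
Definition measures := forall l : 'I_L, Mlayer l.+1.
Definition weights := {l : 'I_L & edge l} -> Lq Sigma (expo2 R).
HB.instance Definition _ := GRing.Lmodule.on weights.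

Definition weights_norm (th : weights) : R := \sum_e Lq_norm Sigma 2 (th e).

(* Lower semicontinuity along weak* convergent sequences, as for the weak lower
   semicontinuity of [generative_prior]. *)
Definition weakstar_lsc l (J : Mlayer l -> \bar R) :=
  forall (mu_ : nat -> Mlayer l) (mu : Mlayer l),
    (forall n (phi : C0 (Om l)), (fun m => mu_ m n phi) @ \oo --> mu n phi) ->
    (J mu <= limn_einf (fun m => J (mu_ m)))%E.

Definition layer_conv (l : 'I_L) (mu : Mlayer l.+1) (th : weights)
    (k : 'I_(N l)) : 'rV[R]_d -> R :=
  fun x => \sum_(e : edge l | (val e).2 == k)
    conv (Om l) Sigma (mu (val e).1) (th (existT _ l e)) x.

(* As [width net 0 = 1], layer 0 has the single channel [unit1]. *)
Definition layer1 : 'I_L := Ordinal (nlayers_gt0 net).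
Definition unit1 : 'I_(N layer1) := cast_ord (esym (width0 net)) ord0.

Lemma lo_proof (i : 'I_L.-1) : (i < L)%N.
Proof. exact: leq_trans (ltn_ord i) (leq_pred _). Qed.
Lemma hi_proof (i : 'I_L.-1) : (i.+1 < L)%N.
Proof. by rewrite -ltn_predRL. Qed.
Definition lo (i : 'I_L.-1) : 'I_L := Ordinal (lo_proof i).
Definition hi (i : 'I_L.-1) : 'I_L := Ordinal (hi_proof i).

(* mu^l - mu^(l+1) * theta^(l+1) for [l = i + 1]. *)
Definition residual (mu : measures) (th : weights) (i : 'I_L.-1) :
    Mlayer i.+1 :=
  fun n => mu (lo i) n - dens (Om i.+1) (@layer_conv (hi i) (mu (hi i)) th n).

Definition measures_norm (mu : measures) : \bar R :=
  (\sum_(l < L) \sum_(n < N l.+1) dual_norm (mu l n))%E.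

Variables (Nc : nat) (Z : weights -> 'rV[R]_Nc).
Variable J : forall i : 'I_L.-1, Mlayer i.+1 -> \bar R.

Definition energy (mu : measures) (th : weights) : \bar R :=
  (measures_norm mu + \sum_(i < L.-1) @J i (@residual mu th i))%E.

Definition feasible (v : 'rV[R]_d -> R) : set (measures * weights) :=
  [set p : measures * weights | [/\ v = layer_conv (p.1 layer1) p.2 unit1 %[ae leb_on Omega],
               forall e, Lq_norm Sigma 2 (p.2 e) <= 1 & Z p.2 = 0]].

Definition generative_prior (v : 'rV[R]_d -> R) : \bar R :=
  ereal_inf [set energy p.1 p.2 | p in feasible v].

End prior.

(* Main.v *)
Require Import Defs.
From HB Require Import structures.
From mathcomp Require Import all_boot all_order all_algebra.
From mathcomp Require Import all_classical all_reals all_analysis.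
From mathcomp Require Import measurable_realfun ring lra.

Set Implicit Arguments.
Unset Strict Implicit.
Unset Printing Implicit Defensive.

Import Order.TTheory GRing.Theory Num.Theory.
Import numFieldNormedType.Exports.

Local Open Scope classical_set_scope.
Local Open Scope ring_scope.

(** The direct method of the calculus of variations applies.  If
[limn_einf (fun m => generative_prior Z J (v_ m)) < c], there are infinitely
many [m] with a feasible pair [(mu_m, theta_m)] for [v_ m] of energy less than
[c].  The measures are then bounded in total variation and the kernels lie in
the unit ball of [L^2(Sigma)], so a limit [(mu, theta)] exists in the weak* and
weak topologies, and it remains to see that this limit is feasible for [v] and
has energy at most [c].

Limits are taken along one ultrafilter [U] finer than [\oo], not along
subsequences.  Bounded families of reals then converge at once, the limits of
[mu_m phi] define a bounded functional, and the limit of [theta_m] is obtained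
from the Riesz representation theorem [L2_riesz] applied to the functional
[f |-> lim_U <theta_m, f>].

The key point is that [(mu, theta) |-> mu * theta] is continuous for these
topologies.  Integrating [mu * g] against [phi] amounts to applying [mu] to
[C0_correl phi g], that is to [y |-> \int_Sigma phi(x + y) g(x) dx] ([conv_C0]).
The translates of [phi] by [y] are equicontinuous, hence
[C0_correl phi theta_m] converges uniformly on the compact closure of
[w - Sigma] as soon as [theta_m] converges weakly ([C0_correl_cvg]); paired with
the weak* convergent and bounded [mu_m], it converges ([dual_apply_cvg]).  The
existence of [mu * g] is part of the proof ([conv_ex]): by Cauchy-Schwarz and
translation invariance, [phi |-> mu (C0_correl phi g)] is bounded for the [L^2]
norm on [Cc w], hence represented by an [L^2] function, which lies in all [L^q]
with [q <= 2] because [w] is bounded.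

The conclusion follows term by term.  The residuals converge weak*; since the
functionals [J i] are lower semicontinuous along sequences only, a sequence is
extracted from the ultrafilter by means of the separability of [C_0]
([lsc_filter]).  The dual norms are suprema of continuous functions.  The
constraint [Z theta = 0] passes to the limit since each component of [Z] is a
sum of bounded functionals of the single kernels, again represented by [L^2]
functions ([weights_lim_eq0]).  Finally [v] and the first layer of the limit
have the same integral against every [phi] in [C_0(Omega)], so they agree almost
everywhere ([ae0_of_C0]). *)

(** * Square-integrable functions and the Riesz representation theorem *)

Section square_integrable.
Context (R : realType) (dT : measure_display) (T : measurableType dT).
Variable mu : {measure set T -> \bar R}.
Implicit Types f g h : T -> R.
Local Notation L2 := (Lfun mu 2%:E).

Lemma L2_measurable f : f \in L2 -> measurable_fun setT f.
Proof. by move=> /andP[]; rewrite inE. Qed.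

Lemma L2_lin a f g : f \in L2 -> g \in L2 -> (fun x => a * f x + g x) \in L2.
Proof.
move=> fL gL; have p1 : (1 <= (2 : R)%:E)%E by rewrite lee1n.
exact: (Lfun_submod_closed mu p1).2 a f g fL gL.
Qed.

Lemma L2_sub f g : f \in L2 -> g \in L2 -> (fun x => f x - g x) \in L2.
Proof.
move=> fL gL.
suff -> : (fun x => f x - g x) = (fun x => -1 * g x + f x) by exact: L2_lin.
by apply/funext => x; rewrite mulN1r addrC.
Qed.

Lemma Lnorm2E f : ('N[mu]_2%:E[EFin \o f] =
  (\int[mu]_x (f x ^+ 2)%:E) `^ 2^-1)%E.
Proof.
rewrite unlock; congr (_ `^ _)%E; apply: eq_integral => x _ /=.
by rewrite -[2]/(2%:R) powR_mulrn// real_normK// num_real.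
Qed.

Lemma L2P f : measurable_fun setT f ->
  (\int[mu]_x (f x ^+ 2)%:E < +oo)%E -> f \in L2.
Proof.
move=> mf fi; apply/andP; split; rewrite inE//=.
by rewrite /finite_norm Lnorm2E; exact: poweR_lty.
Qed.

Lemma L2_mul_integrable f g : f \in L2 -> g \in L2 ->
  mu.-integrable setT (EFin \o (fun x => f x * g x)).
Proof. by move=> fL gL; apply/Lfun1_integrable; exact: Lfun2_mul_Lfun1. Qed.

Definition inner f g := \int[mu]_x (f x * g x).

Lemma innerC f g : inner f g = inner g f.
Proof. by apply: eq_Rintegral => x _; rewrite mulrC. Qed.

Lemma inner_linl a f g h : f \in L2 -> g \in L2 -> h \in L2 ->
  inner (fun x => a * f x + g x) h = a * inner f h + inner g h.
Proof.
move=> fL gL hL; rewrite /inner -RintegralZl//; last exact: L2_mul_integrable.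
rewrite -RintegralD//.
- by apply: eq_Rintegral => x _; rewrite mulrDl mulrA.
- have := L2_mul_integrable (L2_lin a fL (L2_sub fL fL)) hL.
  by apply: eq_integrable => // x _ /=; rewrite subrr addr0 mulrA.
- exact: L2_mul_integrable.
Qed.

Lemma inner_linr a f g h : f \in L2 -> g \in L2 -> h \in L2 ->
  inner h (fun x => a * f x + g x) = a * inner h f + inner h g.
Proof. by move=> *; rewrite innerC inner_linl// !(innerC h). Qed.

Lemma L2_0 : (fun=> 0) \in L2.
Proof.
have p1 : (1 <= (2 : R)%:E)%E by rewrite lee1n.
exact: (Lfun_submod_closed mu p1).1.
Qed.

Lemma inner0l f : inner (fun=> 0) f = 0.
Proof.
rewrite /inner; under eq_Rintegral do rewrite mul0r.
by rewrite Rintegral_cst// mul0r.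
Qed.

Lemma L2_sum (J : Type) (s : seq J) (P : pred J) (F : J -> T -> R) :
  (forall j, F j \in L2) -> (fun x => \sum_(j <- s | P j) F j x) \in L2.
Proof.
move=> FL; elim: s => [|j s IH].
  by under eq_fun do rewrite big_nil; exact: L2_0.
under eq_fun do rewrite big_cons; case: (P j) => //.
suff -> : (fun x => F j x + \sum_(j <- s | P j) F j x) =
    (fun x => 1 * F j x + \sum_(j <- s | P j) F j x) by exact: L2_lin.
by apply/funext => x; rewrite mul1r.
Qed.

Lemma inner_suml (J : Type) (s : seq J) (P : pred J) (F : J -> T -> R) f :
  (forall j, F j \in L2) -> f \in L2 ->
  inner (fun x => \sum_(j <- s | P j) F j x) f = \sum_(j <- s | P j) inner (F j) f.
Proof.
move=> FL fL; elim: s => [|j s IH].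
  by rewrite big_nil -[RHS](inner0l f); congr inner; apply/funext => x; rewrite big_nil.
rewrite big_cons; case: ifP => Pj; last first.
  by rewrite -IH; congr inner; apply/funext => x; rewrite big_cons Pj.
rewrite -IH -[inner (F j) f]mul1r -inner_linl//; last exact: L2_sum.
by congr inner; apply/funext => x; rewrite big_cons Pj mul1r.
Qed.

Lemma inner_ge0 f : 0 <= inner f f.
Proof. by apply: Rintegral_ge0 => x _; rewrite -expr2 sqr_ge0. Qed.

Lemma inner_ereal f : f \in L2 -> (inner f f)%:E = (\int[mu]_x (f x ^+ 2)%:E)%E.
Proof.
move=> fL; rewrite /inner /Rintegral fineK; last first.
  by apply: integrable_fin_num => //; exact: L2_mul_integrable.
by apply: eq_integral => x _; rewrite expr2.
Qed.

Lemma Lnorm2_inner f : f \in L2 ->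
  fine ('N[mu]_2%:E[EFin \o f])%E = Num.sqrt (inner f f).
Proof.
by move=> fL; rewrite Lnorm2E -inner_ereal// poweR_EFin/= powR12_sqrt// inner_ge0.
Qed.

Lemma inner_quad a f g : f \in L2 -> g \in L2 ->
  inner (fun x => a * f x + g x) (fun x => a * f x + g x) =
  a ^+ 2 * inner f f + 2 * a * inner f g + inner g g.
Proof.
move=> fL gL; rewrite inner_linl//; last exact: L2_lin.
by rewrite !inner_linr// (innerC g f); ring.
Qed.

(** The polynomial [t |-> |t g + f|^2] is nonnegative.  When [g] has a positive
norm, this is used at its minimum; when the norm of [g] is 0 the polynomial is
affine, so that its slope [2 <f, g>] vanishes. *)
Lemma cauchy_schwarz f g : f \in L2 -> g \in L2 ->
  (inner f g) ^+ 2 <= inner f f * inner g g.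
Proof.
move=> fL gL; have [gf|gf] := leP (inner g g) 0.
  have gg0 : inner g g = 0 by apply/eqP; rewrite eq_le gf inner_ge0.
  rewrite gg0 mulr0; set b := inner f g.
  suff -> : b = 0 by rewrite expr0n.
  apply/eqP/negP => /negP b0; pose t := - (inner f f + 1) / (2 * b).
  have := inner_ge0 (fun x => t * g x + f x); rewrite inner_quad// gg0 (innerC g f) -/b.
  have -> : t ^+ 2 * 0 + 2 * t * b + inner f f = -1.
    by rewrite /t; field.
  by rewrite ler0N1.
have := inner_ge0 (fun x => - (inner f g / inner g g) * g x + f x).
rewrite inner_quad// (innerC g f).
have -> : (- (inner f g / inner g g)) ^+ 2 * inner g g +
   2 * - (inner f g / inner g g) * inner f g + inner f f =
   (inner f f * inner g g - inner f g ^+ 2) / inner g g.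
  by field; rewrite gt_eqF.
by rewrite pmulr_lge0 ?invr_gt0// subr_ge0.
Qed.

Lemma normr_inner_le f g : f \in L2 -> g \in L2 ->
  `|inner f g| <= Num.sqrt (inner f f) * Num.sqrt (inner g g).
Proof.
move=> fL gL; rewrite -sqrtrM ?inner_ge0// -sqrtr_sqr ler_wsqrtr//.
exact: cauchy_schwarz.
Qed.

Lemma telescope_le (u : nat -> R) (s : R) : 0 <= s ->
  (forall n, `|u n.+1 - u n| <= s * 2^-1 ^+ n) ->
  forall n k, `|u (n + k)%N - u n| <= 2 * s * 2^-1 ^+ n.
Proof.
move=> s0 us n k.
suff H : `|u (n + k)%N - u n| <= 2 * s * (2^-1 ^+ n - 2^-1 ^+ (n + k)).
  apply: (le_trans H); rewrite ler_wpM2l ?mulr_ge0// lerBlDr lerDl.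
  by rewrite exprn_ge0.
elim: k => [|k IH]; first by rewrite addn0 !subrr normr0 mulr0.
rewrite addnS -(subrK (u (n + k)%N) (u _.+1)) -addrA.
rewrite (le_trans (ler_normD _ _))//; apply: (le_trans (lerD (us _) IH)).
by rewrite exprS; lra.
Qed.

Lemma cvg_half : (fun n => (2^-1 : R) ^+ n) @ \oo --> (0 : R).
Proof.
have := @cvg_geometric R 1 2^-1.
rewrite ger0_norm// invf_lt1// ltr1n => /(_ isT).
by apply: cvg_trans; apply: near_eq_cvg; apply: nearW => n; rewrite /= mul1r.
Qed.

Lemma half_small (e : R) : 0 < e -> exists n, (2^-1 : R) ^+ n < e.
Proof.
move=> e0; have /cvgrPdist_lt/(_ _ e0) := cvg_half.
case=> n _ /(_ n (leqnn n)) /=.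
by rewrite sub0r normrN ger0_norm ?exprn_ge0//; exists n.
Qed.

Lemma cvg_telescope (u : nat -> R) (s : R) : 0 <= s ->
  (forall n, `|u n.+1 - u n| <= s * 2^-1 ^+ n) -> cvgn u.
Proof.
move=> s0 us; apply: cauchy_cvg; apply: cauchy_exP => e e0.
have s1 : 0 < 2 * s + 1 by rewrite ltr_wpDl// mulr_ge0.
have [n ne] := half_small (divr_gt0 e0 s1).
exists (u n); exists n => // k /= nk; rewrite /ball/= distrC.
rewrite -(subnKC nk) (le_lt_trans (telescope_le s0 us n _))//.
move: ne; rewrite ltr_pdivlMr// => /le_lt_trans; apply.
by rewrite mulrC ler_wpM2l ?exprn_ge0// lerDl.
Qed.

(** Completeness of [L^2], for fast Cauchy sequences.  If
[W = sum 4^n (f_(n+1) - f_n)^2], then [|f_(n+1) - f_n| <= sqrt W 2^-n]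
pointwise, so that [f_n] converges where [W] is finite, with a limit [h] that
satisfies [(h - f_n)^2 <= 4 W 4^-n].  As [W] is integrable, this gives at once
convergence almost everywhere and in [L^2]. *)
Lemma L2_complete (f : nat -> T -> R) : (forall n, f n \in L2) ->
  (forall n, inner (fun x => f n.+1 x - f n x) (fun x => f n.+1 x - f n x) <=
     (8^-1) ^+ n) ->
  exists2 h, h \in L2 &
    (fun n => inner (fun x => h x - f n x) (fun x => h x - f n x)) @ \oo --> (0 : R).
Proof.
move=> fL fD; pose D n x := f n.+1 x - f n x.
have DL n : D n \in L2 by exact: L2_sub.
have mD n : measurable_fun setT (D n) by exact: L2_measurable.
pose W x := (\sum_(n <oo) (4 ^+ n * D n x ^+ 2)%:E)%E.
have t0 n x : (0 <= (4 ^+ n * D n x ^+ 2)%:E)%E.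
  by rewrite lee_fin mulr_ge0 ?sqr_ge0 ?exprn_ge0.
have mt n : measurable_fun setT (fun x => (4 ^+ n * D n x ^+ 2)%:E).
  apply/measurable_EFinP; apply: measurable_funM => //.
  exact: measurable_funX.
have mW : measurable_fun setT W by exact: ge0_emeasurable_sum.
have intW : (\int[mu]_x W x <= 2%:E)%E.
  rewrite /W integral_nneseries//.
  have <- : (\sum_(n <oo) ((2^-1 : R) ^+ n)%:E = 2%:E)%E.
    apply/cvg_lim => //; have := @cvg_geometric_eseries_half R 2 0.
    rewrite expr0 divr1; apply: cvg_trans; apply: near_eq_cvg; apply: nearW => n.
    apply: eq_bigr => k _.
    by rewrite addn1 natrX exprS invfM mulrA divff// mul1r exprVn.
  apply: lee_nneseries => [n _ _|n _]; first exact: integral_ge0.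
  under eq_integral do rewrite EFinM.
  rewrite ge0_integralZl ?lee_fin ?exprn_ge0//; last 2 first.
  - by apply/measurable_EFinP; exact: measurable_funX.
  - by move=> x _; rewrite lee_fin sqr_ge0.
  rewrite -inner_ereal// -EFinM lee_fin.
  have -> : (2^-1 : R) ^+ n = 4 ^+ n * 8^-1 ^+ n.
    by rewrite -exprMn; congr (_ ^+ _); field.
  by apply: ler_wpM2l; [exact: exprn_ge0|exact: fD].
(* Off [A], which is a null set, the sequence is replaced by 0 so that it
converges everywhere; the bound by [W] is void there. *)
pose A := [set x | W x \is a fin_num].
have mA : measurable A.
  have := emeasurable_fin_num measurableT mW; by rewrite setTI.
pose g n x := if x \in A then f n x else 0.
have W0 x : (0 <= W x)%E by exact: nneseries_ge0.
have gW x n : A x -> `|g n.+1 x - g n x| <= Num.sqrt (fine (W x)) * 2^-1 ^+ n.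
  move=> Ax; rewrite /g mem_set// -sqrtr_sqr -/(D n x).
  have -> : (2^-1 : R) ^+ n = Num.sqrt (4^-1 ^+ n).
    have -> : (4^-1 : R) ^+ n = (2^-1 ^+ n) ^+ 2.
      by rewrite -exprM mulnC exprM; congr (_ ^+ _); field.
    by rewrite sqrtr_sqr ger0_norm// exprn_ge0.
  rewrite -sqrtrM ?fine_ge0// ler_wsqrtr//.
  rewrite exprVn ler_pdivlMr ?exprn_gt0// mulrC.
  rewrite -lee_fin fineK//.
  apply: le_trans (nneseries_lim_ge n.+1 _); last by move=> *.
  rewrite big_nat_recr//= leeDr// sume_ge0// => *; exact: t0.
have cg x : cvgn (g ^~ x).
  have [Ax|nAx] := pselect (A x).
    by apply: (cvg_telescope (sqrtr_ge0 (fine (W x)))) => n; exact: gW.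
  by apply: is_cvg_near_cst; apply: nearW => n; rewrite /g memNset.
pose h x := limn (g ^~ x).
have mfn n : measurable_fun setT (f n) by exact: L2_measurable.
have mg n : measurable_fun setT (g n).
  apply: measurable_fun_ifT => //.
  apply: (measurable_fun_bool true); rewrite setTI.
  suff -> : (fun x => x \in A) @^-1` [set true] = A by [].
  by apply/seteqP; split => x /=; [exact: set_mem|exact: mem_set].
have mh : measurable_fun setT h.
  by apply: (@measurable_fun_cvg _ _ _ _ g) => // x _; exact: cg.
have hW n x : (((h x - f n x) ^+ 2)%:E <= (4 * 4^-1 ^+ n)%:E * W x)%E.
  have [Ax|/negP nAx] := boolP (W x \is a fin_num); last first.
    have -> : W x = +oo%E.
      by move: nAx (W0 x); rewrite fin_numE; case: (W x).
    by rewrite gt0_muley ?leey// lte_fin mulr_gt0 ?exprn_gt0.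
  rewrite -(fineK Ax) -EFinM lee_fin.
  have : `|h x - f n x| <= 2 * Num.sqrt (fine (W x)) * 2^-1 ^+ n.
    have -> : f n x = g n x by rewrite /g mem_set.
    have cv : (fun k => `|g (n + k)%N x - g n x|) @ \oo --> `|h x - g n x|.
      apply: cvg_norm; apply: cvgB; last exact: cvg_cst.
      have := cg x; rewrite -/(h x) => cgx.
      under eq_fun do rewrite addnC.
      by have := cgx; rewrite -(cvg_shiftn n (g ^~ x)).
    apply: (cvgr_to_le cv); apply: nearW => k /=.
    apply: (@telescope_le (g ^~ x)); first exact: sqrtr_ge0.
    by move=> m; exact: gW.
  have s0 : 0 <= 2 * Num.sqrt (fine (W x)) * 2^-1 ^+ n.
    by rewrite !mulr_ge0 ?sqrtr_ge0 ?exprn_ge0.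
  move=> hf; have : `|h x - f n x| ^+ 2 <= (2 * Num.sqrt (fine (W x)) * 2^-1 ^+ n) ^+ 2.
    by rewrite lerXn2r ?nnegrE.
  rewrite real_normK ?num_real// => /le_trans; apply.
  rewrite !exprMn sqr_sqrtr ?fine_ge0//.
  have -> : (4^-1 : R) ^+ n = (2^-1 ^+ n) ^+ 2.
    by rewrite -exprM mulnC exprM; congr (_ ^+ _); field.
  by rewrite le_eqVlt; apply/orP; left; apply/eqP; ring.
have hfi n : (\int[mu]_x ((h x - f n x) ^+ 2)%:E <= (8 * 4^-1 ^+ n)%:E)%E.
  apply: le_trans (_ : (\int[mu]_x ((4 * 4^-1 ^+ n)%:E * W x) <= _)%E).
    apply: ge0_le_integral => //.
    - by move=> x _; rewrite lee_fin sqr_ge0.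
    - apply/measurable_EFinP/measurable_funX; exact: measurable_funB.
    - apply: emeasurable_funM => //.
  rewrite ge0_integralZl ?lee_fin ?mulr_ge0 ?exprn_ge0//.
  apply: le_trans (lee_wpmul2l _ intW) _.
    by rewrite lee_fin mulr_ge0 ?exprn_ge0.
  by rewrite -EFinM lee_fin; lra.
have hfL n : (fun x => h x - f n x) \in L2.
  apply: L2P; first exact: measurable_funB.
  exact: le_lt_trans (hfi n) (ltry _).
exists h.
  suff -> : h = (fun x => 1 * (h x - f 0%N x) + f 0%N x) by exact: L2_lin.
  by apply/funext => x; rewrite mul1r subrK.
apply: (@squeeze_cvgr _ _ _ _ (fun=> 0) (fun n => 8 * 2^-1 ^+ n)).
- apply: nearW => n; rewrite inner_ge0/= -lee_fin inner_ereal// (le_trans (hfi n))//.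
  rewrite lee_fin ler_wpM2l// lerXn2r ?nnegrE//.
  by rewrite lef_pV2 ?posrE// ler_nat.
- exact: cvg_cst.
- by rewrite -[X in _ --> X](mulr0 8); apply: cvgM cvg_half; exact: cvg_cst.
Qed.

Lemma sqrD_le (x y p q : R) : x ^+ 2 <= p -> y ^+ 2 <= q ->
  (x + y) ^+ 2 <= 2 * p + 2 * q.
Proof. by move=> xp yq; have := sqr_ge0 (x - y); nra. Qed.

(** The representing function minimises [|f|^2 - 2 l f]: a minimising sequence
is Cauchy by the parallelogram identity, and its limit solves the Euler-Lagrange
equation [<h, v> = l v].  Since [V] need not be closed, the lemma also applies
to functionals that are only given on a subspace, such as that of the compactly
supported continuous functions. *)
Lemma L2_riesz (V : set (T -> R)) (l : (T -> R) -> R) (C : R) :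
  (forall f, V f -> f \in L2) -> V (fun=> 0) ->
  (forall a f g, V f -> V g -> V (fun x => a * f x + g x)) ->
  (forall a f g, V f -> V g -> l (fun x => a * f x + g x) = a * l f + l g) ->
  (forall f, V f -> `|l f| <= C * Num.sqrt (inner f f)) ->
  exists2 h, h \in L2 & forall f, V f -> inner h f = l f.
Proof.
move=> VL V0 Vlin llin lC; pose Phi f := inner f f - 2 * l f.
have PhiC f : V f -> - C ^+ 2 <= Phi f.
  move=> Vf; have := lC _ Vf; have := ler_norm (l f).
  have := sqr_sqrtr (inner_ge0 f); set s := Num.sqrt _ => sE lf lCs.
  rewrite /Phi -sE; have := sqr_ge0 (s - C); rewrite sqrrB; lra.
pose I := inf [set Phi f | f in V].
have hI : has_inf [set Phi f | f in V].
  split; first by exists (Phi (fun=> 0)), (fun=> 0).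
  by exists (- C ^+ 2) => _ [f Vf <-]; exact: PhiC.
have PhiI f : V f -> I <= Phi f by move=> Vf; apply: ge_inf; [exact: hI.2|exists f].
(* With this precision the parallelogram identity below yields exactly the
rate that [L2_complete] asks for. *)
pose eps n : R := 8^-1 ^+ n / 4.
have eps0 n : 0 < eps n by rewrite divr_gt0 ?exprn_gt0.
have ex n : exists f, V f /\ Phi f < I + eps n.
  by have [_ [f Vf <-] fI] := inf_adherent (eps0 n) hI; exists f.
pose f n := sval (cid (ex n)).
have Vf n : V (f n) by have [] := svalP (cid (ex n)).
have fI n : Phi (f n) < I + eps n by have [] := svalP (cid (ex n)).
have par g k : V g -> V k -> inner (fun x => g x - k x) (fun x => g x - k x) =
    2 * Phi g + 2 * Phi k - 4 * Phi (fun x => 2^-1 * g x + (2^-1 * k x + 0)).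
  move=> Vg Vk; have [Lg Lk] := (VL _ Vg, VL _ Vk).
  have -> : (fun x => g x - k x) = (fun x => -1 * k x + g x).
    by apply/funext => x; rewrite mulN1r addrC.
  have l0 : l (fun=> 0) = 0.
    rewrite -[RHS](addNr (l (fun=> 0))) -mulN1r -llin//.
    by congr l; apply/funext => x; rewrite mulr0 addr0.
  have Vk2 := Vlin 2^-1 _ _ Vk V0.
  have Lk2 := VL _ Vk2; have L0 := VL _ V0.
  rewrite /Phi llin// llin// l0 !inner_quad//.
  have inner0 (u : T -> R) : inner u (fun=> 0) = 0 by rewrite innerC inner0l.
  rewrite inner_linr// !inner0 (innerC g k).
  by field.
have [h hL hf] : exists2 h, h \in L2 &
    (fun n => inner (fun x => h x - f n x) (fun x => h x - f n x)) @ \oo --> (0 : R).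
  apply: L2_complete => [n|n]; first exact: VL.
  rewrite par//.
  have := PhiI _ (Vlin 2^-1 _ _ (Vf n.+1) (Vlin 2^-1 _ _ (Vf n) V0)).
  have := fI n; have := fI n.+1.
  have : eps n.+1 <= eps n.
    by rewrite ler_pM2r ?invr_gt0// exprS ler_piMl ?exprn_ge0// invf_le1// ler1n.
  have -> : (8^-1 : R) ^+ n = 4 * eps n by rewrite /eps; field.
  lra.
exists h => // v Vv; set c := inner h v; set B := inner v v.
have vL := VL _ Vv.
have B0 : 0 <= B by exact: inner_ge0.
(* The Euler-Lagrange equation holds approximately at [f n]: compare [Phi] at
[f n] and at [f n + t v] for the almost optimal [t = - b / (B + 1)]. *)
have bn n : (inner (f n) v - l v) ^+ 2 <= (B + 1) * eps n.
  set b := _ - _.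
  have B1 : 0 < B + 1 by rewrite ltr_wpDl.
  have := PhiI _ (Vlin (- b / (B + 1)) _ _ Vv (Vf n)).
  rewrite /Phi llin// inner_quad//; last exact: VL.
  rewrite -/B (innerC v) => H.
  have {}H : 0 <= (- b / (B + 1)) ^+ 2 * B + 2 * (- b / (B + 1)) * b + eps n.
    have := fI n; rewrite /Phi; move: H; rewrite /b; lra.
  have E : (- b / (B + 1)) ^+ 2 * B + 2 * (- b / (B + 1)) * b =
      - (b ^+ 2 / (B + 1)) - b ^+ 2 / (B + 1) ^+ 2.
    by field; rewrite gt_eqF.
  rewrite mulrC -ler_pdivrMr//.
  have : 0 <= b ^+ 2 / (B + 1) ^+ 2 by rewrite divr_ge0 ?sqr_ge0.
  move: H; rewrite E; lra.
have cle n : (c - l v) ^+ 2 <=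
    2 * (inner (fun x => h x - f n x) (fun x => h x - f n x) * B) +
    2 * ((B + 1) * eps n).
  have fnL : f n \in L2 by exact: VL.
  have -> : c - l v = inner (fun x => h x - f n x) v + (inner (f n) v - l v).
    have -> : (fun x => h x - f n x) = (fun x => -1 * f n x + h x).
      by apply/funext => x; rewrite mulN1r addrC.
    by rewrite inner_linl// /c; ring.
  have := cauchy_schwarz (L2_sub hL fnL) vL; have := bn n; rewrite -/B.
  by move=> HY HX; exact: sqrD_le.
suff : (c - l v) ^+ 2 <= 0.
  by rewrite real_exprn_even_le0 ?num_real//= subr_eq0 => /eqP.
have cv : (fun n => 2 * (inner (fun x => h x - f n x) (fun x => h x - f n x) * B) +
    2 * ((B + 1) * eps n)) @ \oo --> (2 * (0 * B) + 2 * ((B + 1) * (0 * 4^-1)) : R).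
  apply: cvgD; apply: cvgM; try exact: cvg_cst.
    by apply: cvgM hf _; exact: cvg_cst.
  apply: cvgM; first exact: cvg_cst.
  apply: cvgM; last exact: cvg_cst.
  have := @cvg_geometric R 1 8^-1.
  rewrite ger0_norm// invf_lt1// ltr1n => /(_ isT); apply: cvg_trans.
  by apply: near_eq_cvg; apply: nearW => n; rewrite /= mul1r.
move: cv; rewrite !(mul0r, mulr0) addr0 => cv.
by apply: (cvgr_to_ge cv); exact: nearW.
Qed.

End square_integrable.

(** * The space C_0: truncation, separability, test functions *)

Section continuity.
Context (R : realType) (T : topologicalType).
Implicit Types f g : T -> R.

Lemma continuous_normB (V : normedModType R) (f g : T -> V) :
  continuous f -> continuous g -> continuous (fun x => `|f x - g x|).
Proof. by move=> cf cg x; apply: cvg_norm; apply: cvgB; [exact: cf|exact: cg]. Qed.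

Lemma continuous_truncate f e : continuous f ->
  continuous (fun x => Num.max (f x - e) 0 + Num.min (f x + e) 0).
Proof.
move=> cf x; apply: cvgD.
  apply: (@continuous_max _ _ (fun x => f x - e) (cst 0)); last exact: cvg_cst.
  by apply: cvgB; [exact: cf|exact: cvg_cst].
apply: (@continuous_min _ _ (fun x => f x + e) (cst 0)); last exact: cvg_cst.
by apply: cvgD; [exact: cf|exact: cvg_cst].
Qed.

Lemma continuous_maxr f a : continuous f -> continuous (fun x => Num.max (f x) a).
Proof.
move=> cf x; apply: (@continuous_max _ _ f (cst a)); first exact: cf.
exact: cvg_cst.
Qed.

Lemma continuous_minr f a : continuous f -> continuous (fun x => Num.min (f x) a).
Proof.
move=> cf x; apply: (@continuous_min _ _ f (cst a)); first exact: cf.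
exact: cvg_cst.
Qed.

Lemma continuous_subl f a : continuous f -> continuous (fun x => a - f x).
Proof. by move=> cf x; apply: cvgB; [exact: cvg_cst|exact: cf]. Qed.

Lemma continuous_scale_sum n (f : nat -> T -> R) a : (forall k, continuous (f k)) ->
  continuous (fun x => a * \sum_(k < n) f k x).
Proof.
move=> cf x; apply: cvgM; first exact: cvg_cst.
elim: n => [|n IH].
  by rewrite big_ord0; under eq_fun do rewrite big_ord0; exact: cvg_cst.
rewrite big_ord_recr/=; under eq_fun do rewrite big_ord_recr/=.
by apply: cvgD IH _; exact: cf.
Qed.

End continuity.

Lemma bounded_subset (R : realType) (V : normedModType R) (A B : set V) :
  A `<=` B -> bounded_set B -> bounded_set A.
Proof.
by move=> AB [M [Mr BM]]; exists M; split => // y My x /AB; exact: BM.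
Qed.

Lemma bounded_closure (R : realType) (V : normedModType R) (A : set V) :
  bounded_set A -> bounded_set (closure A).
Proof.
move=> [M [Mr AM]]; exists M; split => // y My.
have cy : closed [set x : V | `|x| <= y].
  have -> : [set x : V | `|x| <= y] = (fun x => `|x|) @^-1` [set t | t <= y] by [].
  by apply: closed_comp; [move=> x _; exact: norm_continuous|exact: closed_le].
have S : A `<=` [set x : V | `|x| <= y] by move=> z; exact: AM.
by move=> x /(closureS S); rewrite -((closure_id _).1 cy).
Qed.

Section C0_functions.
Context (R : realType) (d : nat).
Implicit Types w : openset R d.

Lemma C0_off w (phi : C0 w) x : ~ oset w x -> phi x = 0.
Proof.
move=> nwx; apply/eqP; rewrite -normr_le0; apply/ler_addgt0Pr => e e0.
rewrite add0r; have /asboolP/(_ e e0)[g [_ _ gw] pg] := C0_funP phi.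
suff g0 : g x = 0 by rewrite -(subr0 (phi x)) -g0.
by apply/eqP/negPn/negP => gx; apply: nwx; apply: gw; exact: subset_closure.
Qed.

Lemma Cc_C0 w f : Cc w f -> f \in C0_pred w.
Proof.
by move=> Cf; apply/asboolP => e e0; exists f => // x; rewrite subrr normr0 ltW.
Qed.

(** Truncating [f] at height [e] moves its support into the set where
[e <= |f|], which is closed, bounded and contained in [w]. *)
Lemma C0_vanish w f : bounded_set (oset w) -> continuous f ->
  (forall x, ~ oset w x -> f x = 0) -> f \in C0_pred w.
Proof.
move=> wb cf f0; apply/asboolP => e e0.
pose g x := Num.max (f x - e) 0 + Num.min (f x + e) 0.
have gE x : `|f x - g x| <= e /\ (g x != 0 -> e <= `|f x|).
  rewrite /g; case: (leP (f x - e) 0) => h1; case: (leP (f x + e) 0) => h2;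
    rewrite ?addr0 ?add0r; (split; [rewrite ler_norml; apply/andP; split; lra|]).
  - by move=> _; rewrite ler_normr; apply/orP; right; lra.
  - by rewrite eqxx.
  - by move=> _; rewrite ler_normr; apply/orP; right; lra.
  - by move=> _; rewrite ler_normr; apply/orP; left; lra.
have cg : continuous g by exact: continuous_truncate.
pose K := [set x | e <= `|f x|].
have cK : closed K.
  have -> : K = (fun x => `|f x|) @^-1` [set y | e <= y] by [].
  apply: closed_comp; last exact: closed_ge.
  move=> x _; have -> : (fun x => `|f x|) = (fun x => `|f x - 0|).
    by apply/funext => y; rewrite subr0.
  by apply: continuous_normB => //; exact: cst_continuous.
have Kw : K `<=` oset w.
  move=> x; rewrite /K /= => ex; apply: contrapT => /f0 fx0; move: ex.
  by rewrite fx0 normr0 leNgt e0.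
have sK : closure [set x | g x != 0] `<=` K.
  by move=> x; rewrite (closure_id K).1//; apply: closureS => y /= /((gE y).2).
exists g; last by move=> x; exact: (gE x).1.
split => //.
- apply: (subclosed_compact (@closed_closure _ _) _ sK).
  apply: bounded_closed_compact => //; exact: bounded_subset Kw wb.
- exact: subset_trans Kw.
Qed.

(** A finite family of rational balls, each with a rational value, and a
precision [n], which stands for [1/(n+1)]. *)
Definition pattern := (seq ('rV[rat]_d * rat * rat) * nat)%type.

Definition matches w (p : pattern) (f : C0 w) :=
  (forall x, oset w x -> exists2 q, q \in p.1 & @ratball R d q.1 x) /\
  (forall q, q \in p.1 -> forall x, @ratball R d q.1 x ->
     `|f x - ratr q.2| <= p.2.+1%:R^-1).

Lemma matches_dist w (p : pattern) (f g : C0 w) : matches p f -> matches p g ->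
  forall x, `|f x - g x| <= 2 / p.2.+1%:R.
Proof.
move=> [wf pf] [_ pg] x; have [wx|nwx] := pselect (oset w x); last first.
  by rewrite !C0_off// subrr normr0 divr_ge0.
have [q qp qx] := wf x wx.
have := pf q qp x qx; have := pg q qp x qx.
move=> gx fx; apply: (le_trans (ler_distD (ratr q.2) _ _)).
by rewrite (distrC (ratr _)) mulr_natl mulr2n lerD.
Qed.

Lemma matches_ex w (n : nat) (f : C0 w) : bounded_set (oset w) ->
  exists p : pattern, matches p f /\ p.2 = n.
Proof.
move=> wb; have n0 : (0 : R) < n.+1%:R^-1 by rewrite invr_gt0.
pose good := [set q : 'rV[rat]_d * rat * rat |
  forall x, @ratball R d q.1 x -> `|f x - ratr q.2| <= n.+1%:R^-1].
have : compact (closure (oset w)).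
  by apply: bounded_closed_compact; [exact: bounded_closure|exact: closed_closure].
rewrite compact_cover => /(_ _ good (fun q => @ratball R d q.1)).
case.
- by move=> q _; exact: ball_open.
- move=> x _.
  have [a /[!in_itv]/= /andP[a1 a2]] : exists a,
      ratr a \in `]f x - n.+1%:R^-1, f x + n.+1%:R^-1[.
    by apply: rat_in_itvoo; rewrite ltrD2l gt0_cp.
  pose U := (fun y => `|f y - ratr a|) @^-1` [set t | t < n.+1%:R^-1].
  have oU : open U.
    apply: open_comp; last exact: open_lt.
    move=> y _; apply: (@continuous_normB _ _ _ f (cst (ratr a))).
      exact: C0_continuous.
    exact: cst_continuous.
  have : U x by rewrite /U/= ltr_distlC a1 a2.
  rewrite (open_ratballE oU) => -[q /= qU qx].
  by exists (q, a) => // y qy; apply/ltW; exact: qU.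
move=> D Dgood wD; exists (finmap.enum_fset D, n); split => //; split => /=.
  by move=> x /subset_closure/wD[q qD qx]; exists q.
by move=> q qD; have := Dgood q qD; rewrite inE.
Qed.

(** A continuous function on the compact closure of [w] is known up to [2/(n+1)]
from a finite cover by rational balls on each of which it is within [1/(n+1)] of
a rational.  There are countably many such patterns, and a dense sequence is
obtained by choosing one function for each pattern that is matched at all. *)
Lemma C0_separable w : bounded_set (oset w) ->
  exists D : nat -> C0 w, forall (f : C0 w) e, 0 < e -> exists k, `|f - D k| <= e.
Proof.
move=> wb; pose rep p : C0 w := xget 0 [set f | matches p f].
exists (fun k => if unpickle k is Some p then rep p else 0) => f e e0.
have [n ne] : exists n, 2 / n.+1%:R <= e.
  have := near_infty_natSinv_lt (PosNum (divr_gt0 e0 (ltr0n R 2))) => -[n _].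
  move=> /(_ n (leqnn n)) /= ne; exists n.
  by rewrite mulrC -ler_pdivlMr// ltW.
have [p [pf pn]] := matches_ex n f wb; exists (pickle p); rewrite pickleK.
have pr : matches p (rep p) by apply: (@xgetPex _ 0 [set g | matches p g]); exists f.
apply: C0_norm_le => x; apply: le_trans ne; rewrite -pn.
exact: matches_dist pf pr x.
Qed.

(** The [k]-th rational ball, in some enumeration, carries a tent function if it
lies in [V]; the positivity sets of the tents then cover [V] when [V] is open. *)
Definition tent (V : set 'rV[R]_d) (k : nat) (x : 'rV[R]_d) : R :=
  if unpickle k is Some q then
    if `[< @ratball R d q `<=` V >] then Num.max (ratr q.2 - `|map_mx ratr q.1 - x|) 0
    else 0
  else 0.

Lemma tent_ge0 V k x : 0 <= tent V k x.
Proof.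
rewrite /tent; case: unpickle => // q; case: ifP => // _.
by rewrite le_max lexx orbT.
Qed.

Lemma tent_off V k x : ~ V x -> tent V k x = 0.
Proof.
move=> nVx; rewrite /tent; case: unpickle => // q; case: asboolP => // qV.
apply/max_idPr; rewrite subr_le0 leNgt; apply/negP => qx; apply: nVx; apply: qV.
by rewrite /ratball -ball_normE.
Qed.

Lemma tent_on V x : open V -> V x -> exists k, 0 < tent V k x.
Proof.
move=> oV; rewrite {1}(open_ratballE oV) => -[q /= qV qx].
exists (pickle q); rewrite /tent pickleK; case: asboolP => // _.
by rewrite lt_max subr_gt0; move: qx; rewrite /ratball -ball_normE /= => ->.
Qed.

Lemma tent_continuous V k : continuous (tent V k).
Proof.
rewrite /tent; case: (unpickle k) => [q|]; last exact: cst_continuous.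
case: (`[< _ >]); last exact: cst_continuous.
apply: continuous_maxr; apply: continuous_subl; apply: continuous_normB.
  exact: cst_continuous.
by move=> x; exact: cvg_id.
Qed.

(** Continuous functions between 0 and 1 that converge pointwise to the indicator
function of the open set [V]. *)
Definition cutoff V n x := Num.min (n%:R * \sum_(k < n) tent V k x) 1.

Lemma cutoff_C0 w V n : bounded_set (oset w) -> V `<=` oset w ->
  cutoff V n \in C0_pred w.
Proof.
move=> wb Vw; apply: C0_vanish => //.
  apply: continuous_minr; apply: (@continuous_scale_sum _ _ _ (tent V)) => k.
  exact: tent_continuous.
move=> x nwx; rewrite /cutoff big1 ?mulr0.
  by apply/min_idPl; exact: ler01.
by move=> k _; apply: tent_off => /Vw.
Qed.

Lemma cutoff_ge0 V n x : 0 <= cutoff V n x.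
Proof.
by rewrite le_min ler01 mulr_ge0// sumr_ge0// => k _; exact: tent_ge0.
Qed.

Lemma cutoff_le1 V n x : cutoff V n x <= 1.
Proof. by rewrite ge_min lexx orbT. Qed.

Lemma cutoff_cvg V x : open V -> cutoff V ^~ x @ \oo --> (\1_V x : R).
Proof.
move=> oV; have [Vx|nVx] := pselect (V x).
  have [k t0] := tent_on oV Vx.
  rewrite indicE mem_set//; apply: cvg_near_cst; near=> n.
  apply/min_idPr; apply: le_trans (_ : n%:R * tent V k x <= _).
    rewrite -ler_pdivrMr// div1r; near: n; exact: nbhs_infty_ger.
  rewrite ler_wpM2l//.
  have kn : (k < n)%N by near: n; exact: nbhs_infty_gt.
  rewrite (bigD1 (Ordinal kn))//= lerDl sumr_ge0// => j _; exact: tent_ge0.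
rewrite indicE memNset//; apply: cvg_near_cst; apply: nearW => n.
rewrite /cutoff big1 ?mulr0; first by apply/min_idPl; exact: ler01.
by move=> k _; exact: tent_off.
Unshelve. all: by end_near. Qed.

Lemma leb_on_off w : leb_on w (~` oset w) = 0%E.
Proof. by rewrite /leb_on /mrestr/= /mrestr setICl measure0. Qed.

Lemma measurable_oset w : measurable (oset w).
Proof. by apply: open_measurable_rV; exact: oset_open. Qed.

Lemma integral_leb_on w (A : set 'rV[R]_d) (f : 'rV[R]_d -> \bar R) :
  measurable A -> measurable_fun setT f ->
  (\int[leb_on w]_(x in A) f x = \int[leb_on w]_(x in A `&` oset w) f x)%E.
Proof.
move=> mA mf; have mw := measurable_oset w.
have mAw : measurable (A `&` ~` oset w).
  by apply: measurableI => //; exact: measurableC.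
rewrite -[in LHS](setIT A) -(setUv (oset w)) setIUr integral_setU//=.
- rewrite [X in (_ + X)%E](_ : _ = 0%E) ?adde0//.
  apply: null_set_integral => //; first exact: measurable_funS mf.
  apply: (@subset_measure0 _ _ _ (leb_on w) _ (~` oset w)) => //.
  + exact: measurableC.
  + exact: leb_on_off.
- exact: measurableI.
- exact: measurable_funS mf.
- by rewrite disj_set2E setIACA setICr setI0.
Qed.

Lemma integral_leb_onE w (f : 'rV[R]_d -> \bar R) : measurable_fun setT f ->
  (\int[leb_on w]_x f x = \int[lebesgue_rV R d]_(x in oset w) f x)%E.
Proof.
move=> mf; rewrite integral_leb_on// setTI.
by apply: eq_measure_integral => A mA Aw; rewrite /leb_on/= /mrestr setIidl.
Qed.

(** Dominated convergence along the cutoff functions of [V]. *)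
Lemma integral_open_eq0 w h (V : set 'rV[R]_d) : bounded_set (oset w) ->
  h \in Lfun (leb_on w) 1 ->
  (forall phi : C0 w, \int[leb_on w]_x (h x * phi x) = 0) ->
  open V -> V `<=` oset w -> (\int[leb_on w]_(x in V) (h x)%:E)%E = 0%E.
Proof.
move=> wb hL h0 oV Vw; have ih := (Lfun1_integrable _ _).1 hL.
have mh : measurable_fun setT h by apply/measurable_EFinP; exact: measurable_int ih.
have mt n : measurable_fun setT (cutoff V n : 'rV[R]_d -> R).
  exact: (C0_measurable (MkC0 (cutoff_C0 n wb Vw))).
have mV : measurable V by exact: open_measurable_rV.
rewrite integral_mkcond.
have := @dominated_cvg _ _ _ (leb_on w) setT measurableT
  (fun n x => (h x * cutoff V n x)%:E) (fun x => (h x * \1_V x)%:E) (fun x => `|h x|%:E).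
have -> : (fun n => \int[leb_on w]_x (h x * cutoff V n x)%:E)%E = (fun=> 0%E).
  apply/funext => n.
  have H := h0 (MkC0 (cutoff_C0 n wb Vw)).
  rewrite -(fineK (integrable_fin_num measurableT
    (integrable_C0 (MkC0 (cutoff_C0 n wb Vw)) hL))).
  by congr EFin.
move=> H; have {H} : (fun=> 0%E) @ \oo --> (\int[leb_on w]_x (h x * \1_V x)%:E)%E.
  apply: H.
  - by move=> n; apply/measurable_EFinP; exact: measurable_funM.
  - move=> x _; apply/fine_cvgP; split; first exact: nearW.
    by apply: cvgM; [exact: cvg_cst|exact: cutoff_cvg].
  - by [].
  - by apply/Lfun1_integrable; exact: Lfun_norm.
  - move=> n x _; rewrite lee_fin normrM (ger0_norm (cutoff_ge0 _ _ _)).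
    by rewrite ler_piMr// cutoff_le1.
move/(cvg_unique (@ereal_hausdorff R) (cvg_cst _)) => E; rewrite -[RHS]/0%E E.
by apply: eq_integral => x _; rewrite patchE indicE; case: ifP => _;
  rewrite ?mulr1 ?mulr0.
Qed.

(** The fundamental lemma of the calculus of variations: the integrals of [h]
over open sets vanish, hence over all Borel sets by Dynkin's lemma. *)
Lemma ae0_of_C0 w h : bounded_set (oset w) -> h \in Lfun (leb_on w) 1 ->
  (forall phi : C0 w, \int[leb_on w]_x (h x * phi x) = 0) ->
  h = (fun=> 0) %[ae leb_on w].
Proof.
move=> wb hL h0; have ih := (Lfun1_integrable _ _).1 hL.
have mh : measurable_fun setT (EFin \o h) by exact: measurable_int ih.
have ihA A : measurable A -> (leb_on w).-integrable A (EFin \o h).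
  by move=> mA; apply: integrableS ih.
have hw A : measurable A -> (\int[leb_on w]_(x in A) (h x)%:E =
    \int[leb_on w]_(x in A `&` oset w) (h x)%:E)%E.
  by move=> mA; rewrite integral_leb_on.
have hopen V : open V -> (\int[leb_on w]_(x in V) (h x)%:E)%E = 0%E.
  move=> oV; rewrite hw; last exact: open_measurable_rV.
  by apply: integral_open_eq0 => //; apply: openI => //; exact: oset_open.
have hT := hopen _ openT.
have h0A A : measurable A -> (\int[leb_on w]_(x in A) (h x)%:E)%E = 0%E.
  move: A; apply: (@dynkin_induction _ 'rV[R]_d (@open 'rV[R]_d)
    (fun A => (\int[leb_on w]_(x in A) (h x)%:E)%E = 0%E)) => //.
  - exact: openI.
  - move=> S mS hS; have := hT; rewrite -(setUv S) integral_setU//=.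
    + by rewrite hS add0e.
    + exact: measurableC.
    + by rewrite setUv.
    + by rewrite disj_set2E setICr.
  - move=> F mF tF hF; rewrite integral_bigcup//; last first.
      by apply: ihA; exact: bigcup_measurable.
    by rewrite eseries0.
have : ae_eq (leb_on w) setT (EFin \o h) (fun=> 0%E).
  by apply: integral_ae_eq => // E _ mE; rewrite h0A// integral0.
by apply: filterS => x /(_ I)/= [].
Qed.

End C0_functions.

(** * Lebesgue measure: translation invariance, finiteness on bounded sets *)

Lemma pushforward_measure_ex d1 d2 (T1 : measurableType d1) (T2 : measurableType d2)
    (R : realType) (m : {measure set T1 -> \bar R}) (f : T1 -> T2) :
  measurable_fun setT f ->
  exists m' : {measure set T2 -> \bar R}, forall A, m' A = m (f @^-1` A).
Proof.
move=> mf.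
by exists (measure_function_pushforward__canonical__measure_function_Measure m mf).
Qed.

Section lebesgue_translation.
Context (R : realType).

Lemma measurable_shiftR (a : R) :
  measurable_fun setT ((fun t => t + a) : measurableTypeR R -> measurableTypeR R).
Proof. by apply: measurable_funD; [exact: measurable_id|exact: measurable_cst]. Qed.

Lemma lebesgue_measure_shift (a : R) (A : set (measurableTypeR R)) : measurable A ->
  lebesgue_measure ((fun t => t + a) @^-1` A) = lebesgue_measure A.
Proof.
have [m' m'E] := pushforward_measure_ex (@lebesgue_measure R) (measurable_shiftR a).
rewrite -m'E; move: A; suff H : forall A : set (measurableTypeR R), measurable A ->
    lebesgue_measure A = m' A by move=> A mA; rewrite H.
apply: lebesgue_measure_unique => _ [[b c] _ <-]; rewrite m'E /=.
have -> : (fun t => t + a) @^-1` `]b, c] = `]b - a, c - a]%classic.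
  by apply/seteqP; split => t /=; rewrite !in_itv/= ltrBlDr lerBrDr.
rewrite !lebesgue_measure_itv/= !lte_fin ltrD2r; case: ifP => // _.
by rewrite -!EFinB opprD addrACA addrN addr0.
Qed.

Lemma measurable_shift_rV d (a : 'rV[R]_d) :
  measurable_fun setT (fun x : 'rV[R]_d => x + a).
Proof.
apply: measurable_fun_rV => i; under eq_fun do rewrite mxE.
by apply: measurable_funD; [exact: measurable_coord|exact: measurable_cst].
Qed.

Lemma cons_rVl d (p : measurableTypeR R * 'rV[R]_d) (j : 'I_1) :
  cons_rV p ord0 (lshift d j) = p.1.
Proof. by apply: etrans (row_mxEl _ _ _ _) _; rewrite mxE. Qed.

Lemma cons_rVr d (p : measurableTypeR R * 'rV[R]_d) (j : 'I_d) :
  cons_rV p ord0 (rshift 1 j) = p.2 ord0 j.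
Proof. exact: row_mxEr. Qed.

Lemma cons_rVD d (p : measurableTypeR R * 'rV[R]_d) (a : 'rV[R]_d.+1) :
  cons_rV p + a = cons_rV (p.1 + (uncons_rV a).1, p.2 + (uncons_rV a).2).
Proof.
rewrite -[in LHS](uncons_rVK a) /cons_rV; set q := uncons_rV a.
apply: etrans (@add_row_mx _ 1 1 d _ _ _ _) _.
by congr (row_mx _ _); apply/rowP => i; rewrite !mxE.
Qed.

(** By induction on [d]: under the identification of R^(d+1) with R x R^d the
translation acts on each factor, and a product measure is determined by its
values on rectangles. *)
Lemma lebesgue_rV_shift d (a : 'rV[R]_d) (A : set 'rV[R]_d) : measurable A ->
  lebesgue_rV R d ((fun x => x + a) @^-1` A) = lebesgue_rV R d A.
Proof.
elim: d a A => [a A mA|d IH a A mA].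
  by congr (lebesgue_rV R 0 _); apply/seteqP; split => x /=;
    rewrite (_ : x + a = x)//; apply/rowP; case.
rewrite /= /leb_step /pushforward.
set nu := lebesgue_rV R d; set a0 := (uncons_rV a).1; set a' := (uncons_rV a).2.
pose tau (p : measurableTypeR R * 'rV[R]_d) : measurableTypeR R * 'rV[R]_d :=
  (p.1 + a0, p.2 + a').
have mtau : measurable_fun setT tau.
  apply/measurable_fun_pairP; split.
    exact: (measurableT_comp (measurable_shiftR a0) measurable_fst).
  exact: (measurableT_comp (measurable_shift_rV a') measurable_snd).
have mB : measurable (@cons_rV R d @^-1` A).
  by rewrite -[X in measurable X]setTI; exact: measurable_cons_rV.
have -> : @cons_rV R d @^-1` ((fun x => x + a) @^-1` A) = tau @^-1` (@cons_rV R d @^-1` A).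
  by apply/seteqP; split => p /=; rewrite cons_rVD.
have [m' m'E] := pushforward_measure_ex (lebesgue_measure \x nu)%E mtau.
rewrite -m'E; apply/esym; apply: product_measure_unique => // C D mC mD.
rewrite m'E.
have -> : tau @^-1` (C `*` D) = ((fun t => t + a0) @^-1` C) `*` ((fun x => x + a') @^-1` D).
  by apply/seteqP; split.
have mC' : measurable ((fun t : measurableTypeR R => t + a0) @^-1` C).
  by rewrite -[X in measurable X]setTI; exact: measurable_shiftR.
have mD' : measurable ((fun x : 'rV[R]_d => x + a') @^-1` D).
  by rewrite -[X in measurable X]setTI; exact: measurable_shift_rV.
apply: etrans (product_measure1E _ _ mC' mD') _.
by congr (_ * _)%E; [exact: lebesgue_measure_shift|exact: IH].
Qed.

Lemma ge0_integral_shift d (a : 'rV[R]_d) (f : 'rV[R]_d -> \bar R) :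
  measurable_fun setT f -> (forall x, (0 <= f x)%E) ->
  (\int[lebesgue_rV R d]_x f (x + a)%R = \int[lebesgue_rV R d]_x f x)%E.
Proof.
move=> mf f0.
rewrite -[LHS](ge0_integral_pushforward (measurable_shift_rV a) _ measurableT)//.
apply: eq_measure_integral => [|mf' A mA _]; first exact: measurable_shift_rV.
exact: (lebesgue_rV_shift a mA).
Qed.

Lemma cube_lty d (M : R) :
  measurable [set x : 'rV[R]_d | forall i, `|x ord0 i| <= M] /\
  (lebesgue_rV R d [set x : 'rV[R]_d | forall i, `|x ord0 i| <= M]%R < +oo)%E.
Proof.
have mI : measurable (`[- M, M]%classic : set R) by exact: measurable_itv.
have mcube n : measurable [set x : 'rV[R]_n | forall i, `|x ord0 i| <= M].
  rewrite (_ : [set x | _] = \bigcap_(i in [set: 'I_n])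
     (setT `&` (fun x : 'rV[R]_n => x ord0 i) @^-1` `[- M, M])).
    apply: fin_bigcap_measurable => [|i _]; first exact: finite_finset.
    exact: measurable_coord.
  apply/seteqP; split => x /= Mx.
    by move=> i _; split => //=; rewrite in_itv/= -ler_norml.
  by move=> i; have [_ /=] := Mx i I; rewrite in_itv/= -ler_norml.
split => //; elim: d => [|d IH].
  by rewrite /= diracE; case: (_ \in _); rewrite ltry.
rewrite /= /leb_step /pushforward.
have -> : @cons_rV R d @^-1` [set x | forall i, `|x ord0 i| <= M] =
    (`[- M, M]%classic : set (measurableTypeR R)) `*`
      [set x : 'rV[R]_d | forall i, `|x ord0 i| <= M].
  apply/seteqP; split => -[t v] /=.
    move=> H; split => [|i].
      by have := H (lshift d (ord0 : 'I_1)); rewrite in_itv/= -ler_norml cons_rVl.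
    by have := H (rshift 1 i); rewrite cons_rVr.
  rewrite in_itv/= -ler_norml => -[tM vM] i.
  by case: (@split_ordP 1 d i) => j ->; rewrite (cons_rVl, cons_rVr).
have mc := mcube d.
have fI : @lebesgue_measure R `[- M, M]%classic \is a fin_num.
  by rewrite lebesgue_measure_itv/=; case: ifP.
rewrite product_measure1E//; apply: lte_mul_pinfty.
- exact: measure_ge0.
- exact: fI.
- exact: IH.
Qed.

Lemma le_coord_norm n (x : 'rV[R]_n) i : `|x ord0 i| <= `|x|.
Proof.
have /mapP[j Hj ->] : `|x ord0 i| \in [seq `|x p.1 p.2| | p : 'I_1 * 'I_n].
  by apply/mapP; exists (ord0, i) => //=; rewrite mem_enum.
by rewrite [leRHS]/Num.norm /= mx_normrE; apply/bigmax_geP; right => /=; exists j.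
Qed.

Lemma bounded_lty d (A : set 'rV[R]_d) : measurable A -> bounded_set A ->
  (lebesgue_rV R d A < +oo)%E.
Proof.
move=> mA [M [_ AM]]; have [mc cy] := cube_lty d (M + 1).
apply: le_lt_trans cy; apply: le_measure; rewrite ?inE//.
move=> x /(AM (M + 1)) /= xM i; apply: le_trans (le_coord_norm x i) _.
by apply: xM; rewrite ltrDl.
Qed.

End lebesgue_translation.

(** * Integrals over bounded open sets *)

Section finite_volume.
Context (R : realType) (d : nat).
Implicit Types w : openset R d.

Lemma leb_on_fin w : bounded_set (oset w) -> leb_on w setT \is a fin_num.
Proof.
move=> wb; rewrite /leb_on/= /mrestr setTI ge0_fin_numE ?measure_ge0//.
by apply: bounded_lty wb; exact: measurable_oset.
Qed.

Lemma L2_bounded w (f : 'rV[R]_d -> R) B : bounded_set (oset w) -> measurable_fun setT f ->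
  (forall x, `|f x| <= B) -> f \in Lfun (leb_on w) 2%:E.
Proof.
move=> wb mf fB; apply: L2P => //.
apply: (@le_lt_trans _ _ (\int[leb_on w]_x (B ^+ 2)%:E)%E).
  apply: ge0_le_integral => //.
  - by move=> x _; rewrite lee_fin sqr_ge0.
  - by apply/measurable_EFinP; exact: measurable_funX.
  - move=> x _; rewrite lee_fin -real_normK ?num_real//.
    by rewrite lerXn2r ?nnegrE// (le_trans _ (fB x)).
rewrite integral_cst//; have := leb_on_fin wb.
by move/fineK => <-; rewrite -EFinM ltry.
Qed.

Lemma L2_C0 w' w (phi : C0 w') : bounded_set (oset w) ->
  (phi : _ -> _) \in Lfun (leb_on w) 2%:E.
Proof.
move=> wb; have [B pB] := C0_bounded phi.
by apply: L2_bounded pB => //; exact: C0_measurable.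
Qed.

Lemma L2_shift w' w (phi : C0 w') y : bounded_set (oset w) ->
  (fun x => phi (x + y)) \in Lfun (leb_on w) 2%:E.
Proof.
move=> wb; have [B pB] := C0_bounded phi.
apply: (@L2_bounded _ _ B) => // x.
exact: (measurableT_comp (C0_measurable phi) (measurable_shift_rV y)).
Qed.

Lemma L2_L1 w f : bounded_set (oset w) -> f \in Lfun (leb_on w) 2%:E ->
  f \in Lfun (leb_on w) 1.
Proof. by move=> wb; apply: Lfun_subset12; exact: leb_on_fin. Qed.

Definition L1norm w (g : 'rV[R]_d -> R) := \int[leb_on w]_x `|g x|.

Lemma L1norm_ge0 w g : 0 <= L1norm w g.
Proof. exact: Rintegral_ge0. Qed.

Lemma L1norm_le w : bounded_set (oset w) -> exists2 A, 0 <= A &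
  forall g, g \in Lfun (leb_on w) 2%:E ->
    L1norm w g <= A * Num.sqrt (inner (leb_on w) g g).
Proof.
move=> wb; pose one := (fun=> 1) : 'rV[R]_d -> R.
have L1 : one \in Lfun (leb_on w) 2%:E.
  apply: (@L2_bounded _ _ 1) => //; first exact: measurable_cst.
  by move=> x; rewrite /one normr1.
exists (Num.sqrt (inner (leb_on w) one one)); first exact: sqrtr_ge0.
move=> g gL; have mg := L2_measurable gL.
have agL : (fun x => `|g x|) \in Lfun (leb_on w) 2%:E.
  apply: L2P; first exact: measurableT_comp.
  under eq_integral do rewrite real_normK ?num_real//.
  by rewrite -inner_ereal// ltry.
have := normr_inner_le L1 agL; rewrite /inner.
have -> : \int[leb_on w]_x (one x * `|g x|) = L1norm w g.
  by apply: eq_Rintegral => x _; rewrite mul1r.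
rewrite ger0_norm ?L1norm_ge0//.
have -> // : \int[leb_on w]_x (`|g x| * `|g x|) = \int[leb_on w]_x (g x * g x).
by apply: eq_Rintegral => x _; rewrite -normrM ger0_norm// -expr2 sqr_ge0.
Qed.

(** The measure [leb_on w] does not see [f] outside [w], so the sharp constant
[C] only needs to bound [f] on [w]; the global bound [B] ensures
integrability. *)
Lemma normr_int_mul_le w (f g : 'rV[R]_d -> R) B C : 0 <= C -> g \in Lfun (leb_on w) 1 ->
  measurable_fun setT f -> (forall x, `|f x| <= B) ->
  (forall x, oset w x -> `|f x| <= C) ->
  `|\int[leb_on w]_x (f x * g x)| <= C * L1norm w g.
Proof.
move=> C_ge0 gL mf fB fC.
have ig := (Lfun1_integrable _ _).1 gL.
have mg : measurable_fun setT g by apply/measurable_EFinP; exact: measurable_int ig.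
have ifg : (leb_on w).-integrable setT (EFin \o (fun x => f x * g x)).
  have : (leb_on w).-integrable setT (EFin \o (fun x => g x * f x)).
    apply: (integrableMl measurableT ig mf).
    by exists B; split; [exact: num_real|move=> y By x _; exact: le_trans (fB x) (ltW By)].
  by apply: eq_integrable => // x _ /=; rewrite mulrC.
have mw := measurable_oset w.
have on (k : 'rV[R]_d -> R) : measurable_fun setT k ->
    \int[leb_on w]_x k x = \int[leb_on w]_(x in oset w) k x.
  move=> mk; rewrite /Rintegral integral_leb_on ?setTI//.
  exact/measurable_EFinP.
have sub (k : 'rV[R]_d -> R) : (leb_on w).-integrable setT (EFin \o k) ->
    (leb_on w).-integrable (oset w) (EFin \o k).
  by apply: integrableS.
have ing : (leb_on w).-integrable setT (EFin \o (fun x => `|g x|)).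
  by apply/Lfun1_integrable; exact: Lfun_norm.
apply: (le_trans (le_normr_Rintegral _ ifg)) => //.
rewrite /L1norm !on; last 2 first.
- by apply: measurableT_comp => //; exact: measurable_funM.
- exact: measurableT_comp.
rewrite -RintegralZl//; last exact: sub.
apply: le_Rintegral => //.
- apply: sub; apply/Lfun1_integrable.
  by apply: (@Lfun_norm _ _ _ _ (fun x => f x * g x)); apply/Lfun1_integrable.
- apply: (@eq_integrable _ _ _ _ _ mw (fun x => C%:E * `|g x|%:E)%E) => //.
  by apply: integrableZl => //; exact: sub.
- by move=> x wx; rewrite normrM ler_wpM2r// fC.
Qed.

Lemma bounded_setsub (A B : set 'rV[R]_d) : bounded_set A -> bounded_set B ->
  bounded_set (setsub A B).
Proof.
move=> [M [Mr AM]] [N [Nr BN]]; exists (M + N); split; first exact: num_real.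
move=> e MNe _ [a Aa [b Bb <-]]; pose t := (e - (M + N)) / 2.
have t0 : 0 < t by rewrite divr_gt0// subr_gt0.
apply: (le_trans (ler_normB _ _)).
have -> : e = (M + t) + (N + t) by rewrite /t; field.
by apply: lerD; [apply: AM|apply: BN] => //; rewrite ltrDl.
Qed.

Lemma bounded_Omegas (Omega Sigma : openset R d) l :
  bounded_set (oset Omega) -> bounded_set (oset Sigma) ->
  bounded_set (oset (Omegas Omega Sigma l)).
Proof. by move=> bO bS; elim: l => // l IH; exact: bounded_setsub. Qed.

End finite_volume.

(** * Bounded functionals and the dual norm *)

Section dual_bound.
Context (R : realType) (V : normedModType R).

Lemma dual_linear (u : dual V) a x y : u (a *: x + y) = a * u x + u y.
Proof. by have /asboolP[lu _] := dual_funP u; exact: lu. Qed.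

Lemma dual0 (u : dual V) : u 0 = 0.
Proof.
by have := dual_linear u (-1) 0 0; rewrite scaler0 addr0 mulN1r addNr.
Qed.

Lemma dualZ (u : dual V) a x : u (a *: x) = a * u x.
Proof. by rewrite -[a *: x]addr0 dual_linear dual0 addr0. Qed.

Lemma dualB (u : dual V) x y : u (x - y) = u x - u y.
Proof. by rewrite addrC -scaleN1r dual_linear mulN1r addrC. Qed.

Lemma dual_bounded (u : dual V) : exists2 K, 0 <= K & forall x, `|u x| <= K * `|x|.
Proof.
have /asboolP[_ cu] := dual_funP u.
have /cvgrPdist_le/(_ 1 ltr01)/nbhs_ballP[e /= e0 eu] := cu 0.
exists (2 / e); first by rewrite divr_ge0// ltW.
move=> x; have [->|x0] := eqVneq x 0; first by rewrite dual0 !normr0 mulr0.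
have nx : 0 < `|x| by rewrite normr_gt0.
pose t := e / 2 / `|x|; have t0 : 0 < t by rewrite !divr_gt0.
have /eu : ball 0 e (t *: x).
  rewrite -ball_normE /= sub0r normrN normrZ gtr0_norm// /t divfK ?gt_eqF//.
  by rewrite gtr_pMr// invf_lt1// ltr1n.
rewrite /= dual0 sub0r normrN dualZ normrM gtr0_norm// => H.
rewrite -(ler_pM2l t0); apply: (le_trans H).
by rewrite /t le_eqVlt; apply/orP; left; apply/eqP; field; rewrite !gt_eqF.
Qed.

Lemma dual_norm_le (u : dual V) K : (forall x, `|u x| <= K * `|x|) -> 0 <= K ->
  (dual_norm u <= K%:E)%E.
Proof.
move=> uK K0; apply: ge_ereal_sup => _ [x /= x1 <-]; rewrite lee_fin.
by apply: (le_trans (uK x)); rewrite ler_piMr.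
Qed.

Lemma le_dual_norm (u : dual V) K x : (dual_norm u <= K%:E)%E ->
  `|u x| <= K * `|x|.
Proof.
move=> uK; have [->|x0] := eqVneq x 0; first by rewrite dual0 !normr0 mulr0.
have nx : 0 < `|x| by rewrite normr_gt0.
have : (`|u (`|x|^-1 *: x)|%:E <= K%:E)%E.
  apply: le_trans uK; apply: ereal_sup_ubound; exists (`|x|^-1 *: x) => //=.
  by rewrite normrZ normfV normr_id mulVf// gt_eqF.
by rewrite lee_fin dualZ normrM normfV normr_id ler_pdivrMl// mulrC.
Qed.

End dual_bound.

(** * The adjoint of the convolution, and existence of the convolution *)

Section correlation.
Context (R : realType) (d : nat) (w Sigma : openset R d).
Hypotheses (wb : bounded_set (oset w)) (Sb : bounded_set (oset Sigma)).
Local Notation w' := (osetsub w Sigma).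
Local Notation L2 := (Lfun (leb_on Sigma) 2%:E).

Definition correl (phi g : 'rV[R]_d -> R) (y : 'rV[R]_d) : R :=
  \int[leb_on Sigma]_x (phi (x + y) * g x).

Lemma correl_le (phi : C0 w) g y : g \in L2 ->
  `|correl phi g y| <= `|phi| * L1norm Sigma g.
Proof.
move=> gL; apply: (@normr_int_mul_le _ _ _ (fun x => phi (x + y)) _ `|phi|) => //.
- exact: L2_L1.
- exact: L2_measurable (L2_shift phi y Sb).
- by move=> x; exact: C0_norm_ub.
- by move=> x _; exact: C0_norm_ub.
Qed.

Lemma correlB (phi : C0 w) g y y' : g \in L2 ->
  correl phi g y - correl phi g y' =
  \int[leb_on Sigma]_x ((phi (x + y) - phi (x + y')) * g x).
Proof.
move=> gL; rewrite /correl -RintegralB//; try exact: L2_mul_integrable (L2_shift _ _ Sb) gL.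
by apply: eq_Rintegral => x _; rewrite mulrBl.
Qed.

(** The compactness of the closure of [Sigma] makes the continuity of [phi]
uniform in [x]. *)
Lemma near_translate (phi : C0 w) (y : 'rV[R]_d) e : 0 < e ->
  \forall y' \near y, forall x, oset Sigma x -> `|phi (x + y') - phi (x + y)| <= e.
Proof.
move=> e0.
have : compact (closure (oset Sigma)).
  by apply: bounded_closed_compact; [exact: bounded_closure|exact: closed_closure].
rewrite compact_near_coveringP => /(_ _ (nbhs y)
  (fun y' x => `|phi (x + y') - phi (x + y)| <= e) _).
move=> H; have {}H : \forall y' \near y,
    closure (oset Sigma) `<=` (fun x => `|phi (x + y') - phi (x + y)| <= e).
  apply: H => x _.
  have cphi : {for x + y, continuous phi} by exact: C0_continuous.
  have e2 : 0 < e / 2 by rewrite divr_gt0.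
  have /nbhs_ballP[r /= r0 rphi] : \forall z \near x + y, `|phi (x + y) - phi z| <= e / 2.
    by move/(@cvgrPdist_le _ _ _ (nbhs (x + y))) : cphi; exact.
  have r2 : 0 < r / 2 by rewrite divr_gt0.
  exists (ball x (r / 2), ball y (r / 2)) => /=.
    by split; exact: nbhsx_ballx.
  move=> [x' y'] /= [xx' yy'].
  have h1 : `|phi (x + y) - phi (x' + y')| <= e / 2.
    apply: rphi; rewrite -ball_normE /= opprD addrACA.
    move: xx' yy'; rewrite -!ball_normE /= => xx' yy'.
    by apply: le_lt_trans (ler_normD _ _) _; rewrite (splitr r) ltrD.
  have h2 : `|phi (x + y) - phi (x' + y)| <= e / 2.
    apply: rphi; rewrite -ball_normE /= opprD addrACA subrr addr0.
    move: xx'; rewrite -!ball_normE /= => /lt_trans; apply.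
    by rewrite ltr_pdivrMr// ltr_pMr// ltr1n.
  rewrite (splitr e) (le_trans (ler_distD (phi (x + y)) _ _))// lerD//.
  by rewrite distrC.
by apply: filterS H => y' H x Sx; apply: H; exact: subset_closure.
Qed.

Lemma correl_near (phi : C0 w) (y : 'rV[R]_d) e : 0 < e ->
  \forall y' \near y, forall g, g \in L2 ->
    `|correl phi g y' - correl phi g y| <= e * L1norm Sigma g.
Proof.
move=> e0; apply: filterS (near_translate phi y e0) => y' H g gL.
rewrite correlB//.
apply: (@normr_int_mul_le _ _ _ (fun x => phi (x + y') - phi (x + y)) _
  (`|phi| + `|phi|)) => //.
- exact: ltW.
- exact: L2_L1.
- by apply: measurable_funB; exact: L2_measurable (L2_shift phi _ Sb).
- by move=> x; apply: (le_trans (ler_normB _ _)); rewrite lerD// C0_norm_ub.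
Qed.

(** Continuity comes from [correl_near]; if [correl phi g y] is nonzero then
[x + y] lies in [w] for some [x] in [Sigma], whence [y] lies in [w - Sigma]. *)
Lemma correl_in_C0 (phi : C0 w) g : g \in L2 -> correl phi g \in C0_pred w'.
Proof.
move=> gL; apply: C0_vanish; first exact: bounded_setsub.
- move=> y; apply/(@cvgrPdist_le _ _ _ (nbhs y)) => e e0.
  have n1 : 0 < L1norm Sigma g + 1 by rewrite ltr_wpDl// L1norm_ge0.
  have := correl_near phi y (divr_gt0 e0 n1).
  apply: filterS => y' /(_ g gL); rewrite distrC => /le_trans; apply.
  by rewrite -mulrA ler_piMr ?(ltW e0)// mulrC ler_pdivrMr// mul1r lerDl.
- move=> y nwy; rewrite /correl /Rintegral integral_leb_on//; last first.
    apply/measurable_EFinP; apply: measurable_funM (L2_measurable gL).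
    exact: L2_measurable (L2_shift phi y Sb).
  rewrite setTI [X in fine X](_ : _ = 0%E)//; apply: integral0_eq => x Sx.
  rewrite C0_off ?mul0r// => wxy; apply: nwy; exists (x + y) => //.
  by exists x => //; rewrite addrAC subrr add0r.
Qed.

Definition C0_correl (phi g : 'rV[R]_d -> R) : C0 w' := insubd (0 : C0 w') (correl phi g).

Lemma C0_correlE (phi : C0 w) g y : g \in L2 -> C0_correl phi g y = correl phi g y.
Proof. by move=> gL; rewrite /C0_correl val_insubd ifT//; exact: correl_in_C0. Qed.

Lemma C0_correl_le (phi : C0 w) g : g \in L2 -> `|C0_correl phi g| <= `|phi| * L1norm Sigma g.
Proof. by move=> gL; apply: C0_norm_le => y; rewrite C0_correlE// correl_le. Qed.

Lemma C0_correl_lin a (phi psi : C0 w) g : g \in L2 ->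
  C0_correl (a *: phi + psi : C0 w) g = a *: C0_correl phi g + C0_correl psi g.
Proof.
move=> gL; apply/val_inj/funext => y.
rewrite [LHS](C0_correlE _ y gL) [RHS]/= -[RHS]/(a * C0_correl phi g y + C0_correl psi g y).
rewrite !C0_correlE// /correl.
by rewrite -(inner_linl a (L2_shift phi y Sb) (L2_shift psi y Sb) gL).
Qed.

(** Young's inequality from [L^2 * L^2] to [L^oo]: Cauchy-Schwarz for fixed [y],
then translation invariance. *)
Lemma C0_correl_le_L2 (phi : C0 w) g : g \in L2 ->
  `|C0_correl phi g| <=
    Num.sqrt (inner (leb_on w) phi phi) * Num.sqrt (inner (leb_on Sigma) g g).
Proof.
move=> gL; apply: C0_norm_le => y; rewrite C0_correlE//.
have sL := L2_shift phi y Sb.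
apply: (le_trans (normr_inner_le sL gL)); rewrite ler_wpM2r ?sqrtr_ge0// ler_wsqrtr//.
have mp : measurable_fun setT (fun x => (phi x ^+ 2)%:E).
  by apply/measurable_EFinP/measurable_funX; exact: C0_measurable.
have ms : measurable_fun setT (fun x : 'rV[R]_d => (phi (x + y) ^+ 2)%:E).
  by apply/measurable_EFinP/measurable_funX; exact: L2_measurable sL.
rewrite -lee_fin !inner_ereal//; last exact: L2_C0.
rewrite !integral_leb_onE//.
apply: (@le_trans _ _ (\int[lebesgue_rV R d]_x (phi (x + y) ^+ 2)%:E)%E).
  apply: ge0_subset_integral => //; first exact: measurable_oset.
  by move=> x _; rewrite lee_fin sqr_ge0.
rewrite (ge0_integral_shift y mp); last by move=> x; rewrite lee_fin sqr_ge0.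
rewrite [leRHS]integral_mkcond le_eqVlt; apply/orP; left; apply/eqP.
apply: eq_integral => x _; rewrite patchE; case: ifPn => // /negP nwx.
by rewrite C0_off ?expr0n// => wx; apply: nwx; exact/mem_set.
Qed.

(** By [C0_correl_le_L2] the functional [phi |-> mu (C0_correl phi g)] is bounded
for the [L^2] norm on [Cc w], so [L2_riesz] represents it by a function in
[L^2(w)]; the volume of [w] being finite, this function is in every [L^q(w)]
with [q <= 2]. *)
Lemma conv_ex (mu : M w') g : g \in L2 -> exists h, is_conv w Sigma mu g h.
Proof.
move=> gL; have [K K0 muK] := dual_bounded mu.
have hE : exists2 h, h \in Lfun (leb_on w) 2%:E &
    forall phi, Cc w phi -> inner (leb_on w) h phi = mu (C0_correl phi g).
  apply: (@L2_riesz _ _ _ (leb_on w) (Cc w) (fun phi => mu (C0_correl phi g))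
    (K * Num.sqrt (inner (leb_on Sigma) g g))).
  - by move=> f fC; exact: (L2_C0 (MkC0 (Cc_C0 fC)) wb).
  - exact: Cc0.
  - by move=> a f k; exact: Cc_lin.
  - move=> a f k fC kC.
    have := C0_correl_lin a (MkC0 (Cc_C0 fC)) (MkC0 (Cc_C0 kC)) gL.
    by rewrite /= => ->; rewrite dual_linear.
  - move=> f fC; apply: (le_trans (muK _)); rewrite -mulrA ler_wpM2l//.
    by rewrite mulrC; exact: (C0_correl_le_L2 (MkC0 (Cc_C0 fC)) gL).
have [k kL kE] := hE; exists k; split.
  move=> q /andP[q1 q2]; apply: (Lfun_subset _ _ _ _ kL) => //.
  - by rewrite lee_fin ltW.
  - by rewrite lee_fin ler1n.
  - exact: leb_on_fin.
move=> phi phiC; exists (C0_correl phi g); last exact: kE.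
by move=> y _; exact: (C0_correlE (MkC0 (Cc_C0 phiC)) y gL).
Qed.

Lemma conv_L2 (mu : M w') g : g \in L2 -> Defs.conv w Sigma mu g \in Lfun (leb_on w) 2%:E.
Proof.
move=> gL; have [h hc] := conv_ex mu gL.
have [H _] : is_conv w Sigma mu g (Defs.conv w Sigma mu g).
  by apply: (@xgetPex _ (fun=> 0) [set h | is_conv w Sigma mu g h]); exists h.
exact: H (expo2 R).
Qed.

Lemma conv_Cc (mu : M w') g (phi : C0 w) : g \in L2 -> Cc w phi ->
  \int[leb_on w]_x (Defs.conv w Sigma mu g x * phi x) = mu (C0_correl phi g).
Proof.
move=> gL phiC; have [h hc] := conv_ex mu gL.
have [_ H] : is_conv w Sigma mu g (Defs.conv w Sigma mu g).
  by apply: (@xgetPex _ (fun=> 0) [set h | is_conv w Sigma mu g h]); exists h.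
have [psi psiE ->] := H phi phiC; congr (mu _); apply/val_inj/funext => y /=.
have [wy|nwy] := pselect (oset w' y); first by rewrite [LHS]psiE// C0_correlE.
by rewrite (C0_off psi nwy) (C0_off (C0_correl phi g) nwy).
Qed.

(** Both sides are continuous in [phi] for the uniform norm and agree on the
dense subspace of compactly supported functions. *)
Lemma conv_C0 (mu : M w') g (phi : C0 w) : g \in L2 ->
  \int[leb_on w]_x (Defs.conv w Sigma mu g x * phi x) = mu (C0_correl phi g).
Proof.
move=> gL; have hL := conv_L2 mu gL; set h := Defs.conv w Sigma mu g in hL *.
have h1 := L2_L1 wb hL; have [K K0 muK] := dual_bounded mu.
apply/eqP; rewrite -subr_eq0 -normr_le0; apply/ler_addgt0Pr => e e0; rewrite add0r.
pose B := L1norm w h + K * L1norm Sigma g + 1.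
have B0 : 0 < B by rewrite ltr_wpDl// addr_ge0 ?L1norm_ge0// mulr_ge0// L1norm_ge0.
have /asboolP/(_ _ (divr_gt0 e0 B0))[f fC phif] := C0_funP phi.
pose F : C0 w := MkC0 (Cc_C0 fC).
have phiF : `|phi - F| <= e / B by exact: C0_norm_le.
have -> : \int[leb_on w]_x (h x * phi x) - mu (C0_correl phi g) =
    \int[leb_on w]_x ((phi - F) x * h x) - mu (C0_correl (phi - F) g).
  have -> : C0_correl (phi - F) g = C0_correl phi g - C0_correl F g.
    by rewrite addrC -scaleN1r C0_correl_lin// scaleN1r addrC.
  rewrite dualB -(conv_Cc (phi := F) mu gL fC) -/h.
  have -> : \int[leb_on w]_x ((phi - F) x * h x) =
      \int[leb_on w]_x (h x * phi x) - \int[leb_on w]_x (h x * f x).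
    rewrite -RintegralB//.
    - by apply: eq_Rintegral => x _; rewrite -mulrBr mulrC.
    - exact: integrable_C0.
    - exact: (integrable_C0 F h1).
  by ring.
apply: (le_trans (ler_normB _ _)).
have i1 : `|\int[leb_on w]_x ((phi - F) x * h x)| <= `|phi - F| * L1norm w h.
  apply: (@normr_int_mul_le _ _ _ _ _ `|phi - F|) => //.
  - exact: C0_measurable.
  - by move=> x; exact: C0_norm_ub.
  - by move=> x _; exact: C0_norm_ub.
have i2 : `|mu (C0_correl (phi - F) g)| <= `|phi - F| * (K * L1norm Sigma g).
  apply: (le_trans (muK _)); rewrite mulrCA ler_wpM2l//; exact: C0_correl_le.
apply: (le_trans (lerD i1 i2)); rewrite -mulrDr.
apply: (le_trans (ler_wpM2r _ phiF)).
  by rewrite addr_ge0 ?L1norm_ge0// mulr_ge0// L1norm_ge0.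
rewrite -mulrA ler_piMr ?(ltW e0)// mulrC ler_pdivrMr// mul1r /B lerDl//.
Qed.

End correlation.

(** * Limits along ultrafilters *)

Section limits_inferior.
Context (R : realType).
Local Open Scope ereal_scope.

Lemma einfs_le_limn_einf (u : nat -> \bar R) n : einfs u n <= limn_einf u.
Proof.
rewrite limn_einf_lim (cvg_lim _ (@cvg_einfs_sup _ u))//.
by apply: ereal_sup_ubound; exists n.
Qed.

Lemma limn_einf_le (u : nat -> \bar R) c : (forall n, u n <= c) -> limn_einf u <= c.
Proof.
move=> uc; rewrite limn_einf_lim (cvg_lim _ (@cvg_einfs_sup _ u))//.
apply: ge_ereal_sup => _ [n _ <-]; apply: le_trans (uc n).
by apply: ereal_inf_lbound; exists n => /=.
Qed.

Lemma limn_einf_subseq (u : nat -> \bar R) c : limn_einf u < c ->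
  forall n, exists2 m, (n <= m)%N & u m < c.
Proof.
move=> uc n; have := le_lt_trans (einfs_le_limn_einf u n) uc.
by move=> /ereal_inf_lt[_ [m /= nm <-] umc]; exists m.
Qed.

End limits_inferior.

Section ultrafilter_limits.
Context (R : realType) (I : Type) (U : set_system I).

Lemma ultra_bounded_cvg (a : I -> R) B : UltraFilter U -> (\forall i \near U, `|a i| <= B) ->
  exists l : R, a @ U --> l.
Proof.
move=> UU aB; have UP : ProperFilter U by exact: ultra_proper.
have FP : ProperFilter (a @ U) by exact: fmap_proper_filter.
have [] := @segment_compact R (- B) B (a @ U) FP.
  by apply: filterS aB => i /=; rewrite in_itv/= -ler_norml.
move=> l [_ lU]; exists l => A Al.
have [//|nA] := in_ultra_setVsetC (a @^-1` A) UU.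
by have [x []] := lU (~` A) A nA Al.
Qed.

Lemma cvg_sum_seq (J : Type) (s : seq J) (P : pred J) (F : J -> I -> R) (l : J -> R) :
  Filter U -> (forall j, F j @ U --> l j) ->
  (fun i => \sum_(j <- s | P j) F j i) @ U --> \sum_(j <- s | P j) l j.
Proof.
move=> FU Fl; elim: s => [|j s IH].
  by rewrite big_nil; under eq_fun do rewrite big_nil; exact: cvg_cst.
rewrite big_cons; under eq_fun do rewrite big_cons.
by case: (P j) => //; exact: cvgD.
Qed.

(** Lower semicontinuity along [U], stated through upper bounds instead of a
lower limit.  It is stable under sums since, along an ultrafilter, the terms of
a bounded sum of nonnegative terms converge. *)
Definition below_limit (a_ : I -> \bar R) (a : \bar R) :=
  (forall i, (0 <= a_ i)%E) /\
  forall b : R, (\forall i \near U, a_ i <= b%:E)%E -> (a <= b%:E)%E.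

Lemma below_limitD a_ a b_ b : UltraFilter U ->
  below_limit a_ a -> below_limit b_ b ->
  below_limit (fun i => a_ i + b_ i)%E (a + b)%E.
Proof.
move=> UU; have UP : ProperFilter U by exact: ultra_proper.
move=> [a0 al] [b0 bl]; split; first by move=> i; exact: adde_ge0.
move=> c abc.
have ac : \forall i \near U, (a_ i <= c%:E)%E.
  by apply: filterS abc => i; apply: le_trans; rewrite leeDl.
have bc : \forall i \near U, (b_ i <= c%:E)%E.
  by apply: filterS abc => i; apply: le_trans; rewrite leeDr.
have key (u_ : I -> \bar R) u : below_limit u_ u -> (\forall i \near U, (u_ i <= c%:E)%E) ->
    exists2 l : R, (fun i => fine (u_ i)) @ U --> l & (u <= l%:E)%E.
  move=> [u0 ul] uc.
  have ufin : \forall i \near U, u_ i \is a fin_num.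
    apply: filterS uc => i uic; rewrite ge0_fin_numE//.
    exact: le_lt_trans uic (ltry _).
  have [l lE] : exists l : R, (fun i => fine (u_ i)) @ U --> l.
    apply: (@ultra_bounded_cvg _ c UU); near=> i.
    rewrite ger0_norm ?fine_ge0// -lee_fin fineK; last by near: i.
    by near: i.
  exists l => //; apply/lee_addgt0Pr => e e0; rewrite -EFinD; apply: ul; near=> i.
  rewrite -[u_ i]fineK; last by near: i.
  rewrite lee_fin; near: i; apply: (cvgr_le l lE); rewrite ltrDl//.
have [la aE ale] := key _ _ (conj a0 al) ac.
have [lb bE ble] := key _ _ (conj b0 bl) bc.
apply: (le_trans (leeD ale ble)); rewrite -EFinD lee_fin.
apply: (cvgr_to_le (cvgD aE bE)); near=> i; rewrite /= -lee_fin EFinD !fineK.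
- by near: i.
- rewrite ge0_fin_numE//; apply: (@le_lt_trans _ _ c%:E); last exact: ltry.
  by near: i.
- rewrite ge0_fin_numE//; apply: (@le_lt_trans _ _ c%:E); last exact: ltry.
  by near: i.
Unshelve. all: by end_near. Qed.

Lemma below_limit_sum (J : finType) (a_ : I -> J -> \bar R) (a : J -> \bar R) :
  UltraFilter U -> (forall j, below_limit (a_ ^~ j) (a j)) ->
  below_limit (fun i => \sum_j a_ i j)%E (\sum_j a j)%E.
Proof.
move=> UU aj; have UP : ProperFilter U by exact: ultra_proper.
elim: (index_enum J) => [|j s IH].
  rewrite big_nil; under eq_fun do rewrite big_nil.
  by split => // b bU; have [i] := filter_ex bU.
rewrite big_cons; under eq_fun do rewrite big_cons.
exact: below_limitD.
Qed.

(** Banach-Alaoglu: the pointwise limit along an ultrafilter of uniformly bounded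
functionals is linear and obeys the same bound. *)
Lemma dual_cvg (V : normedModType R) (mu_ : I -> dual V) K : UltraFilter U ->
  (forall i x, `|mu_ i x| <= K * `|x|) ->
  exists mu : dual V, forall x, (mu_ ^~ x) @ U --> mu x.
Proof.
move=> UU muK; have UP : ProperFilter U by exact: ultra_proper.
have ex x : exists l : R, (mu_ ^~ x) @ U --> l.
  by apply: (@ultra_bounded_cvg _ (K * `|x|) UU); exact: nearW.
pose m x := sval (cid (ex x)).
have mE x : (mu_ ^~ x) @ U --> m x by exact: svalP (cid (ex x)).
have mlin : linear_for *%R m.
  move=> a x y; apply: (@cvg_unique _ (@Rhausdorff R) _ _ _ _ (mE _)).
  rewrite /= (_ : (fun i => _) = (fun i => a * mu_ i x + mu_ i y)); last first.
    by apply/funext => i; rewrite dual_linear.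
  by apply: cvgD (mE y); apply: cvgM (mE x); exact: cvg_cst.
have mK x : `|m x| <= K * `|x|.
  by apply: (cvgr_to_le (cvg_norm (mE x))); exact: nearW.
have m0 : m 0 = 0.
  by apply/eqP; rewrite -normr_le0; have := mK 0; rewrite normr0 mulr0.
have mB x y : m x - m y = m (x - y).
  by rewrite addrC -mulN1r -mlin scaleN1r addrC.
have mP : m \in @dual_pred R V.
  apply/asboolP; split => // x; apply/(@cvgrPdist_lt _ _ _ (nbhs x)) => e e0.
  have K1 : 0 < `|K| + 1 by rewrite ltr_wpDl.
  near=> y; rewrite mB; apply: (le_lt_trans (mK _)).
  apply: (@le_lt_trans _ _ ((`|K| + 1) * `|x - y|)).
    by rewrite ler_wpM2r// (le_trans (ler_norm _))// lerDl.
  rewrite mulrC -ltr_pdivlMr//; near: y.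
  by apply: cvgr_dist_lt => //; rewrite divr_gt0.
by exists (MkDual mP).
Unshelve. all: by end_near. Qed.

(** Weak compactness of the unit ball of [L^2]: the limit of [<g_ i, f>] along
the ultrafilter is a functional of [f] of norm at most 1. *)
Lemma L2_weak_cvg dT (T : measurableType dT) (mu : {measure set T -> \bar R})
    (g_ : I -> T -> R) : UltraFilter U -> (forall i, g_ i \in Lfun mu 2%:E) ->
  (forall i, Num.sqrt (inner mu (g_ i) (g_ i)) <= 1) ->
  exists2 g, g \in Lfun mu 2%:E & Num.sqrt (inner mu g g) <= 1 /\
    forall f, f \in Lfun mu 2%:E -> (fun i => inner mu (g_ i) f) @ U --> inner mu g f.
Proof.
move=> UU gL g1; have UP : ProperFilter U by exact: ultra_proper.
have gf i f : f \in Lfun mu 2%:E -> `|inner mu (g_ i) f| <= Num.sqrt (inner mu f f).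
  by move=> fL; apply: (le_trans (normr_inner_le (gL i) fL)); rewrite ler_piMl ?sqrtr_ge0.
have ex f : exists l : R, f \in Lfun mu 2%:E -> (fun i => inner mu (g_ i) f) @ U --> l.
  have [fL|_] := boolP (f \in Lfun mu 2%:E); last by exists 0.
  have [l H] := @ultra_bounded_cvg (fun i => inner mu (g_ i) f) _ UU
    (@nearW _ U _ _ (fun i => gf i f fL)).
  by exists l.
pose l f := sval (cid (ex f)).
have lE f : f \in Lfun mu 2%:E -> (fun i => inner mu (g_ i) f) @ U --> l f.
  exact: svalP (cid (ex f)).
have [h hL hE] : exists2 h, h \in Lfun mu 2%:E &
    forall f, f \in Lfun mu 2%:E -> inner mu h f = l f.
  apply: (@L2_riesz _ _ _ mu (fun f => f \in Lfun mu 2%:E) l 1) => //.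
  - exact: L2_0.
  - by move=> a f k fL kL; exact: L2_lin.
  - move=> a f k fL kL.
    apply: (@cvg_unique _ (@Rhausdorff R) _ _ _ _ (lE _ (L2_lin a fL kL))).
    rewrite /= (_ : (fun i => _) = (fun i => a * inner mu (g_ i) f + inner mu (g_ i) k)).
      by apply: cvgD (lE _ kL); apply: cvgM (lE _ fL); exact: cvg_cst.
    by apply/funext => i; rewrite inner_linr.
  - move=> f fL; rewrite mul1r.
    by apply: (cvgr_to_le (cvg_norm (lE _ fL))); apply: nearW => i; exact: gf.
have hfE f : f \in Lfun mu 2%:E -> (fun i => inner mu (g_ i) f) @ U --> inner mu h f.
  by move=> fL; rewrite hE//; exact: lE.
exists h => //; split => //.
have : inner mu h h <= Num.sqrt (inner mu h h).
  apply: (cvgr_to_le (hfE h hL)); apply: nearW => i.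
  exact: le_trans (ler_norm _) (gf i h hL).
rewrite -{1}(sqr_sqrtr (inner_ge0 mu h)); set s := Num.sqrt _ => ss.
have := sqrtr_ge0 (inner mu h h); rewrite -/s => s0.
by have [//|s1] := leP s 1; nra.
Qed.

End ultrafilter_limits.

(** * Weak* convergence of convolutions and lower semicontinuity *)

Section weak_star_convergence.
Context (R : realType) (d : nat) (I : Type) (U : set_system I).
Hypothesis UP : ProperFilter U.

(** The functions [correl phi (g_ i)] are equicontinuous and converge
pointwise, hence uniformly on the compact closure of [w - Sigma]. *)
Lemma C0_correl_cvg (w Sigma : openset R d) (phi : C0 w)
    (g_ : I -> 'rV[R]_d -> R) (g : 'rV[R]_d -> R) :
  bounded_set (oset w) -> bounded_set (oset Sigma) ->
  (forall i, g_ i \in Lfun (leb_on Sigma) 2%:E) -> g \in Lfun (leb_on Sigma) 2%:E ->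
  (forall i, Num.sqrt (inner (leb_on Sigma) (g_ i) (g_ i)) <= 1) ->
  Num.sqrt (inner (leb_on Sigma) g g) <= 1 ->
  (forall f, f \in Lfun (leb_on Sigma) 2%:E ->
     (fun i => inner (leb_on Sigma) (g_ i) f) @ U --> inner (leb_on Sigma) g f) ->
  forall e, 0 < e -> \forall i \near U,
    `|C0_correl w Sigma phi (g_ i) - C0_correl w Sigma phi g| <= e.
Proof.
move=> wb Sb giL gL gi1 g1 gig e e0.
have [A A0 AL] := L1norm_le Sb.
have gA k : k \in Lfun (leb_on Sigma) 2%:E -> Num.sqrt (inner (leb_on Sigma) k k) <= 1 ->
    L1norm Sigma k <= A.
  by move=> kL k1; apply: (le_trans (AL k kL)); rewrite ler_piMr.
have A1 : 0 < A + 1 by rewrite ltr_wpDl.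
(* [A] bounds the [L^1] norms of [g] and of all [g_ i], so that an oscillation
[eta] of the translates of [phi] changes each correlation by at most [e / 3]. *)
pose eta := e / 3 / (A + 1); have eta0 : 0 < eta by rewrite !divr_gt0.
have etaA t : t <= A -> eta * t <= e / 3.
  move=> tA; rewrite /eta -mulrA ler_piMr ?divr_ge0 ?(ltW e0)//.
  by rewrite mulrC ler_pdivrMr// mul1r (le_trans tA)// lerDl.
have : compact (closure (oset (osetsub w Sigma))).
  apply: bounded_closed_compact; last exact: closed_closure.
  by apply: bounded_closure; exact: bounded_setsub.
rewrite compact_near_coveringP => /(_ _ U (fun i y =>
   `|correl Sigma phi (g_ i) y - correl Sigma phi g y| <= e) _) H.
have {}H : \forall i \near U, closure (oset (osetsub w Sigma)) `<=`
    (fun y => `|correl Sigma phi (g_ i) y - correl Sigma phi g y| <= e).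
  apply: H => y _.
  have cy : (fun i => correl Sigma phi (g_ i) y) @ U --> correl Sigma phi g y.
    have := gig _ (L2_shift phi y Sb); rewrite /correl.
    rewrite innerC; under eq_fun do rewrite innerC; exact.
  have e3 : 0 < e / 3 by rewrite divr_gt0.
  exists ([set y' | forall k, k \in Lfun (leb_on Sigma) 2%:E ->
      `|correl Sigma phi k y' - correl Sigma phi k y| <= eta * L1norm Sigma k],
    [set i | `|correl Sigma phi g y - correl Sigma phi (g_ i) y| <= e / 3]) => /=.
    split; first exact: (correl_near Sb phi y eta0).
    by move/cvgrPdist_le : cy; exact.
  move=> [y' i] /= [yy' gi].
  have h1 := le_trans (yy' _ (giL i)) (etaA _ (gA _ (giL i) (gi1 i))).
  have h2 := le_trans (yy' _ gL) (etaA _ (gA _ gL g1)).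
  have -> : e = e / 3 + (e / 3 + e / 3) by field.
  apply: (le_trans (ler_distD (correl Sigma phi (g_ i) y) _ _)); rewrite lerD//.
  apply: (le_trans (ler_distD (correl Sigma phi g y) _ _)); rewrite lerD//.
    by rewrite distrC.
  by rewrite distrC.
apply: filterS H => i H; apply: C0_norm_le => y.
have [wy|nwy] := pselect (oset (osetsub w Sigma) y).
  rewrite -[X in `|X|]/(C0_correl w Sigma phi (g_ i) y - C0_correl w Sigma phi g y).
  by rewrite !C0_correlE//; apply: H; exact: subset_closure.
by rewrite C0_off// normr0 ltW.
Qed.

Lemma dual_apply_cvg (V : normedModType R) (mu_ : I -> dual V) (mu : dual V)
    (t_ : I -> V) (t : V) K :
  (forall i x, `|mu_ i x| <= K * `|x|) -> (forall x, (mu_ ^~ x) @ U --> mu x) ->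
  (forall e, 0 < e -> \forall i \near U, `|t_ i - t| <= e) ->
  (fun i => mu_ i (t_ i)) @ U --> mu t.
Proof.
move=> muK mumu tt; apply/cvgrPdist_le => e e0.
have K1 : 0 < `|K| + 1 by rewrite ltr_wpDl.
have e2 : 0 < e / 2 by rewrite divr_gt0.
near=> i; rewrite distrC.
apply: (le_trans (ler_distD (mu_ i t) _ _)); rewrite (splitr e) lerD//.
  rewrite -dualB (le_trans (muK _ _))//.
  apply: (@le_trans _ _ ((`|K| + 1) * `|t_ i - t|)).
    by rewrite ler_wpM2r// (le_trans (ler_norm _))// lerDl.
  rewrite mulrC -ler_pdivlMr//; near: i; apply: tt; exact: divr_gt0.
rewrite distrC; near: i; have /cvgrPdist_le := mumu t; exact.
Unshelve. all: by end_near. Qed.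

(** Sequential lower semicontinuity extends to limits of bounded families along
arbitrary filters: by separability of [C_0], a sequence extracted from the
family already has the same limit. *)
Lemma lsc_filter (N : nat) (w : openset R d) (J : ('I_N -> M w) -> \bar R)
    (r_ : I -> 'I_N -> M w) (r : 'I_N -> M w) K c :
  bounded_set (oset w) ->
  (forall (mu_ : nat -> 'I_N -> M w) (mu : 'I_N -> M w),
    (forall n (phi : C0 w), (fun m => mu_ m n phi) @ \oo --> mu n phi) ->
    (J mu <= limn_einf (fun m => J (mu_ m)))%E) ->
  (forall i n phi, `|r_ i n phi| <= K * `|phi|) ->
  (forall n (phi : C0 w), (fun i => r_ i n phi) @ U --> r n phi) ->
  (\forall i \near U, J (r_ i) <= c)%E -> (J r <= c)%E.
Proof.
move=> wb lsc rK rr Jc; have [D Dd] := C0_separable wb.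
have rK' n phi : `|r n phi| <= K * `|phi|.
  by apply: (cvgr_to_le (cvg_norm (rr n phi))); exact: nearW.
have ex m : exists i, (J (r_ i) <= c)%E /\
    forall (k : 'I_m.+1) n, `|r n (D k) - r_ i n (D k)| <= m.+1%:R^-1.
  apply: (@filter_ex _ U); near=> i; split; first by near: i.
  near: i; apply: filter_forall => k; apply: filter_forall => n.
  by have /cvgrPdist_le := rr n (D k); apply; rewrite invr_gt0.
pose s m := sval (cid (ex m)).
have sJ m : (J (r_ (s m)) <= c)%E by have [] := svalP (cid (ex m)).
have sD m (k : 'I_m.+1) n : `|r n (D k) - r_ (s m) n (D k)| <= m.+1%:R^-1.
  by have [_] := svalP (cid (ex m)); exact.
apply: le_trans (limn_einf_le sJ); apply: lsc => n phi.
apply/cvgrPdist_le => e e0.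
have K1 : 0 < `|K| + 1 by rewrite ltr_wpDl.
have e3 : 0 < e / 3 by rewrite divr_gt0.
have [k phik] := Dd phi _ (divr_gt0 e3 K1).
have KD (u : M w) : (forall x, `|u x| <= K * `|x|) -> `|u phi - u (D k)| <= e / 3.
  move=> uK; rewrite -dualB (le_trans (uK _))//.
  apply: (@le_trans _ _ ((`|K| + 1) * `|phi - D k|)).
    by rewrite ler_wpM2r// (le_trans (ler_norm _))// lerDl.
  by rewrite mulrC -ler_pdivlMr.
near=> m.
have km : (k < m.+1)%N by near: m; exists k => // m /= ?; rewrite ltnS.
have -> : e = e / 3 + (e / 3 + e / 3) by field.
apply: (le_trans (ler_distD (r n (D k)) _ _)); rewrite lerD//; first exact: KD.
apply: (le_trans (ler_distD (r_ (s m) n (D k)) _ _)); rewrite lerD//.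
  apply: (le_trans (sD m (Ordinal km) n)); apply: ltW; near: m.
  exact: (near_infty_natSinv_lt (PosNum e3)).
by rewrite distrC; exact: KD.
Unshelve. all: by end_near. Qed.

End weak_star_convergence.

(** * The network: limits of measures and kernels *)

Lemma dual_norm_ge0 (R : realType) (V : normedModType R) (u : dual V) :
  (0 <= dual_norm u)%E.
Proof.
apply: ereal_sup_ubound; exists 0; first by rewrite /= normr0.
by rewrite dual0 normr0.
Qed.

Section network_limits.
Context (R : realType) (d : nat) (Omega Sigma : openset R d) (net : network).
Hypotheses (Ob : bounded_set (oset Omega)) (Sb : bounded_set (oset Sigma)).
Local Notation L := (nlayers net).
Local Notation N := (width net).
Local Notation Om := (Omegas Omega Sigma).
Local Notation W := (weights Sigma net).

Let Omb l : bounded_set (oset (Om l)) := bounded_Omegas l Ob Sb.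

Lemma weight_L2 (th : W) e : (th e : _ -> _) \in Lfun (leb_on Sigma) 2%:E.
Proof. exact: LfunP. Qed.

Lemma weight_norm (th : W) e :
  Lq_norm Sigma 2 (th e) = Num.sqrt (inner (leb_on Sigma) (th e) (th e)).
Proof. exact: Lnorm2_inner (weight_L2 th e). Qed.

Lemma layer_conv_L2 (l : 'I_L) (mu : Mlayer Omega Sigma net l.+1) (th : W) k :
  layer_conv mu th k \in Lfun (leb_on (Om l)) 2%:E.
Proof. by apply: L2_sum => e; apply: conv_L2 => //; exact: weight_L2. Qed.

Lemma layer_conv_dens (l : 'I_L) (mu : Mlayer Omega Sigma net l.+1) (th : W) k
    (phi : C0 (Om l)) :
  \int[leb_on (Om l)]_x (layer_conv mu th k x * phi x) =
  \sum_(e : edge net l | (val e).2 == k)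
    mu (val e).1 (C0_correl (Om l) Sigma phi (th (existT _ l e))).
Proof.
have eL (e : edge net l) : Defs.conv (Om l) Sigma (mu (val e).1) (th (existT _ l e))
    \in Lfun (leb_on (Om l)) 2%:E by apply: conv_L2 => //; exact: weight_L2.
rewrite -[LHS]/(inner _ _ _) inner_suml//; last exact: L2_C0.
by apply: eq_bigr => e _; apply: conv_C0 => //; exact: weight_L2.
Qed.

Lemma Lq_of (g : 'rV[R]_d -> R) : g \in Lfun (leb_on Sigma) 2%:E ->
  exists f : Lq Sigma (expo2 R), (f : _ -> _) = g.
Proof. by move=> gL; exists (Lfun_Sub (expo_ge1 (expo2 R)) gL); exact: Lfun_valP. Qed.

Section limit.
Variables (I : Type) (U : set_system I).
Hypothesis UU : UltraFilter U.
Let UP : ProperFilter U := @ultra_proper _ _ UU.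
Variables (mu_ : I -> measures Omega Sigma net) (th_ : I -> W) (c : R).
Arguments mu_ : clear implicits.
Arguments th_ : clear implicits.
Hypothesis muc : forall i, (measures_norm (mu_ i) <= c%:E)%E.
Hypothesis th1 : forall i e, Lq_norm Sigma 2 (th_ i e) <= 1.

Lemma measures_bound i l n phi : `|mu_ i l n phi| <= c * `|phi|.
Proof.
apply: le_dual_norm; apply: le_trans (muc i); rewrite /measures_norm.
have d0 l' n' : (0 <= dual_norm (mu_ i l' n'))%E by exact: dual_norm_ge0.
rewrite (bigD1 l)//= (bigD1 n)//= -addeA leeDl// adde_ge0//.
  by apply: sume_ge0 => n' _; exact: d0.
by apply: sume_ge0 => l' _; apply: sume_ge0 => n' _; exact: d0.
Qed.

Lemma bounded_family_limit : exists (mu : measures Omega Sigma net) (th : W),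
  [/\ forall l n phi, (fun i => mu_ i l n phi) @ U --> mu l n phi,
      forall e f, f \in Lfun (leb_on Sigma) 2%:E ->
        (fun i => inner (leb_on Sigma) (th_ i e) f) @ U --> inner (leb_on Sigma) (th e) f &
      forall e, Lq_norm Sigma 2 (th e) <= 1].
Proof.
have mu_ex (l : 'I_L) n : exists m : M (Om l.+1),
    forall phi, (fun i => mu_ i l n phi) @ U --> m phi.
  by apply: (@dual_cvg _ _ _ _ (fun i => mu_ i l n) c UU) => i phi; exact: measures_bound.
have th_ex e : exists t : Lq Sigma (expo2 R),
    Num.sqrt (inner (leb_on Sigma) t t) <= 1 /\
    forall f, f \in Lfun (leb_on Sigma) 2%:E ->
      (fun i => inner (leb_on Sigma) (th_ i e) f) @ U --> inner (leb_on Sigma) t f.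
  have [||g gL gE] := @L2_weak_cvg _ _ _ _ _ (leb_on Sigma) (fun i => th_ i e) UU.
  - by move=> i; exact: weight_L2.
  - by move=> i; rewrite -weight_norm.
  - by have [t tg] := Lq_of gL; exists t; rewrite tg.
exists (fun l n => sval (cid (mu_ex l n))), (fun e => sval (cid (th_ex e))); split.
- by move=> l n; exact: svalP (cid (mu_ex l n)).
- by move=> e; have [] := svalP (cid (th_ex e)).
- move=> e; rewrite (weight_norm (fun e => sval (cid (th_ex e)))).
  by have [] := svalP (cid (th_ex e)).
Qed.

Variables (mu : measures Omega Sigma net) (th : W).
Arguments mu : clear implicits.
Arguments th : clear implicits.
Hypothesis mu_cvg : forall l n phi, (fun i => mu_ i l n phi) @ U --> mu l n phi.
Hypothesis th_cvg : forall e f, f \in Lfun (leb_on Sigma) 2%:E ->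
  (fun i => inner (leb_on Sigma) (th_ i e) f) @ U --> inner (leb_on Sigma) (th e) f.
Hypothesis th_le1 : forall e, Lq_norm Sigma 2 (th e) <= 1.

Lemma layer_cvg (l : 'I_L) k (phi : C0 (Om l)) :
  (fun i => \int[leb_on (Om l)]_x (layer_conv (mu_ i l) (th_ i) k x * phi x)) @ U -->
  \int[leb_on (Om l)]_x (layer_conv (mu l) th k x * phi x).
Proof.
rewrite layer_conv_dens; under eq_fun do rewrite layer_conv_dens.
apply: cvg_sum_seq => e; apply: (@dual_apply_cvg _ _ _ _ _ _ _ _ _ c).
- by move=> i phi'; exact: measures_bound.
- by move=> phi'; exact: mu_cvg.
- apply: C0_correl_cvg => //.
  + by move=> i; exact: weight_L2.
  + exact: weight_L2.
  + by move=> i; rewrite -weight_norm.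
  + by rewrite -weight_norm.
  + exact: th_cvg.
Qed.

(** The bound is uniform in [i] and in the layer: convergence of the layers on a
dense sequence of test functions then extends to all test functions. *)
Lemma layer_bound : exists2 K, 0 <= K & forall i (l : 'I_L) k (phi : C0 (Om l)),
  `|\int[leb_on (Om l)]_x (layer_conv (mu_ i l) (th_ i) k x * phi x)| <= K * `|phi|.
Proof.
have [A A0 AL] := L1norm_le Sb.
pose K := \sum_(l < L) \sum_(e : edge net l) (`|c| * A).
have cA : 0 <= `|c| * A by rewrite mulr_ge0.
exists K; first by rewrite sumr_ge0// => l _; rewrite sumr_ge0.
move=> i l k phi; rewrite layer_conv_dens (le_trans (ler_norm_sum _ _ _))//.
apply: (@le_trans _ _ (\sum_(e : edge net l) (`|c| * A * `|phi|))).
  rewrite [leRHS](bigID (fun e => (val e).2 == k))/= -[leLHS]addr0 lerD//; last first.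
    by rewrite sumr_ge0// => e _; rewrite mulr_ge0.
  apply: ler_sum => e _; apply: (le_trans (measures_bound _ _ _)).
  apply: (@le_trans _ _ (`|c| * `|C0_correl (Om l) Sigma phi (th_ i (existT _ l e))|)).
    by rewrite ler_wpM2r// ler_norm.
  rewrite -mulrA ler_wpM2l// mulrC.
  have eL := weight_L2 (th_ i) (existT _ l e).
  apply: (le_trans (C0_correl_le (Omb l) Sb phi eL)); rewrite ler_wpM2l//.
  apply: (le_trans (AL _ eL)); rewrite ler_piMr// -weight_norm//.
rewrite -mulr_suml ler_wpM2r// /K.
rewrite [leRHS](bigD1 l)//= lerDl sumr_ge0// => l' _; exact: sumr_ge0.
Qed.

Lemma residual_val (m : measures Omega Sigma net) (t : W) (i : 'I_L.-1) n
    (phi : C0 (Om i.+1)) :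
  residual m t (i := i) n phi = m (lo i) n phi -
    \int[leb_on (Om i.+1)]_x (layer_conv (m (hi i)) t n x * phi x).
Proof.
rewrite -densE//; apply: L2_L1; first exact: Omb.
exact: (layer_conv_L2 (m (hi i)) t n).
Qed.

Lemma residual_lsc (i : 'I_L.-1) (J : Mlayer Omega Sigma net i.+1 -> \bar R) :
  (forall m, 0 <= J m)%E -> weakstar_lsc J ->
  below_limit U (fun k => J (residual (mu_ k) (th_ k) (i := i)))
    (J (residual mu th (i := i))).
Proof.
move=> J0 Jl; split => // b Jb; have [K K0 Kb] := layer_bound.
apply: (@lsc_filter _ _ _ _ UP _ _ _ (fun k => residual (mu_ k) (th_ k) (i := i))
  _ (c + K) _ _ Jl) => //.
- move=> k n phi; rewrite residual_val (le_trans (ler_normB _ _))// mulrDl lerD//.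
    exact: measures_bound.
  exact: (Kb k (hi i) n phi).
- move=> n phi; rewrite residual_val; under eq_fun do rewrite residual_val.
  by apply: cvgB; [exact: mu_cvg|exact: (@layer_cvg (hi i) n phi)].
Qed.

Lemma dual_norm_lsc (l : 'I_L) n :
  below_limit U (fun k => dual_norm (mu_ k l n)) (dual_norm (mu l n)).
Proof.
split; first by move=> k; exact: dual_norm_ge0.
move=> b bU; have [k kb] := filter_ex bU.
apply: dual_norm_le; last by rewrite -lee_fin (le_trans (dual_norm_ge0 _) kb).
move=> x; apply: (cvgr_to_le (cvg_norm (@mu_cvg l n x))).
by apply: filterS bU => j; exact: le_dual_norm.
Qed.

Lemma energy_le (J : forall i : 'I_L.-1, Mlayer Omega Sigma net i.+1 -> \bar R) b :
  (forall i m, 0 <= J i m)%E -> (forall i, weakstar_lsc (J i)) ->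
  (forall k, energy J (mu_ k) (th_ k) <= b%:E)%E -> (energy J mu th <= b%:E)%E.
Proof.
move=> J0 Jl Jb.
suff [_ H] : below_limit U (fun k => energy J (mu_ k) (th_ k)) (energy J mu th).
  by apply: H; exact: nearW.
apply: below_limitD => //.
  apply: below_limit_sum => // l; apply: below_limit_sum => // n.
  exact: dual_norm_lsc.
by apply: below_limit_sum => // i; exact: residual_lsc.
Qed.

(** A component of [Z] is the sum over the edges [e] of the functionals
[g |-> Z (single e g)], each of which is bounded on [L^2(Sigma)], hence of the
form [<k e, g>] and continuous for the weak convergence of the kernels. *)
Lemma weights_lim_eq0 Nc (Z : {linear W -> 'rV[R]_Nc}) :
  (exists C : R, forall t, `|Z t| <= C * weights_norm t) ->
  (forall k, Z (th_ k) = 0) -> Z th = 0.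
Proof.
move=> [C ZC] Z0; apply/rowP => j; rewrite mxE.
pose single (e : {l : 'I_L & edge net l}) (g : Lq Sigma (expo2 R)) : W :=
  fun e' => if e' == e then g else 0.
pose toLq (f : 'rV[R]_d -> R) : Lq Sigma (expo2 R) :=
  insubd (0 : LfunType (leb_on Sigma) (expo_ge1 (expo2 R))) f.
have toLqE f : f \in Lfun (leb_on Sigma) 2%:E -> (toLq f : _ -> _) = f.
  by move=> fL; rewrite /toLq (insubdK _ fL).
have norm_single e g : weights_norm (single e g) = Lq_norm Sigma 2 g.
  rewrite /weights_norm (bigD1 e)//= /single eqxx big1 ?addr0// => e' /negbTE ->.
  by rewrite /Lq_norm Lnorm0//; rewrite gt_eqF// lte_fin.
have rep e : exists2 k, k \in Lfun (leb_on Sigma) 2%:E &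
    forall g : Lq Sigma (expo2 R), inner (leb_on Sigma) k g = Z (single e g) ord0 j.
  have [k kL kE] : exists2 k, k \in Lfun (leb_on Sigma) 2%:E &
      forall f, f \in Lfun (leb_on Sigma) 2%:E ->
        inner (leb_on Sigma) k f = Z (single e (toLq f)) ord0 j.
    apply: (@L2_riesz _ _ _ (leb_on Sigma) (fun f => f \in Lfun (leb_on Sigma) 2%:E)
      (fun f => Z (single e (toLq f)) ord0 j) C) => //.
    - exact: L2_0.
    - by move=> a f g fL gL; exact: L2_lin.
    - move=> a f g fL gL.
      have -> : single e (toLq (fun x => a * f x + g x)) =
          a *: single e (toLq f) + single e (toLq g).
        apply/funext => e'; rewrite -[RHS]/(a *: single e (toLq f) e' + single e (toLq g) e').
        rewrite /single; case: ifP => _; last by rewrite scaler0 addr0.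
        apply/LfuneqP => x; rewrite toLqE; last exact: L2_lin.
        by rewrite -[RHS]/(a * toLq f x + toLq g x) !toLqE.
      by rewrite linearP !mxE.
    - move=> f fL; apply: (le_trans (le_coord_norm _ _)); apply: (le_trans (ZC _)).
      rewrite norm_single -[Lq_norm _ _ _]/(fine _) Lnorm2_inner; last by rewrite toLqE.
      by rewrite toLqE.
  exists k => // g; rewrite kE; last exact: LfunP.
  by congr (Z (single e _) _ _); apply/LfuneqP => x; rewrite toLqE//; exact: LfunP.
pose k e := sval (cid2 (rep e)).
have kL e : k e \in Lfun (leb_on Sigma) 2%:E by rewrite /k; case: cid2.
have kE e (g : Lq Sigma (expo2 R)) : inner (leb_on Sigma) (k e) g = Z (single e g) ord0 j.
  by rewrite /k; case: cid2 => /= ? _; exact.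
have ZE t : Z t ord0 j = \sum_e inner (leb_on Sigma) (t e) (k e).
  have {1}-> : t = \sum_e single e (t e).
    apply/funext => e'; rewrite fct_sumE (bigD1 e')//= /single eqxx big1 ?addr0//.
    by move=> e; rewrite eq_sym => /negbTE ->.
  by rewrite linear_sum summxE; apply: eq_bigr => e _; rewrite innerC kE.
have : (fun i => \sum_e inner (leb_on Sigma) (th_ i e) (k e)) @ U -->
    \sum_e inner (leb_on Sigma) (th e) (k e).
  by apply: cvg_sum_seq => e; exact: th_cvg.
under eq_fun do rewrite -ZE Z0 mxE; rewrite -ZE => H.
by apply: (@cvg_unique _ (@Rhausdorff R) _ _ _ _ H); exact: cvg_cst.
Qed.

End limit.
End network_limits.

(** * Weak convergence in L^q and the conclusion *)

Section main_argument.
Context (R : realType) (d : nat).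

Lemma Lq_L1 (w : openset R d) (q : R) (hq : 1 < q <= 2) (f : Lq w hq) :
  bounded_set (oset w) -> (f : _ -> _) \in Lfun (leb_on w) 1.
Proof.
move=> wb; apply: (Lfun_subset _ (expo_ge1 hq) (leb_on_fin wb) (expo_ge1 hq)) => //.
exact: LfunP.
Qed.

(** Hoelder's inequality against the constant 1, on a set of finite volume. *)
Lemma L1norm_Lq (w : openset R d) (q : R) (hq : 1 < q <= 2) : bounded_set (oset w) ->
  exists2 A, 0 <= A & forall f : Lq w hq, L1norm w f <= A * Lq_norm w q f.
Proof.
move=> wb; have /andP[q1 q2] := hq; have q0 : 0 < q by rewrite (lt_trans ltr01).
pose p := (1 - q^-1)^-1.
have q1' : 0 < 1 - q^-1 by rewrite subr_gt0 invf_lt1.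
have p0 : 0 < p by rewrite invr_gt0.
have Nfin : ('N[leb_on w]_p%:E[EFin \o (fun=> 1%R)] \is a fin_num)%E.
  rewrite (@Lnorm_cst1 _ _ _ (leb_on w)) -(fineK (leb_on_fin wb)) poweR_EFin//.
exists (fine ('N[leb_on w]_p%:E[EFin \o (fun=> 1%R)]))%E; first exact/fine_ge0/Lnorm_ge0.
move=> f; have mf : measurable_fun setT f by [].
have := @hoelder _ _ _ (leb_on w) (fun=> 1) f p q (measurable_cst _) mf p0 q0.
rewrite /p invrK subrK => /(_ erefl); rewrite Lnorm1.
have -> : (\int[leb_on w]_x `|(EFin \o ((fun=> 1) \* f)%R) x| = (L1norm w f)%:E)%E.
  rewrite /L1norm /Rintegral fineK; last first.
    apply: integrable_fin_num => //; apply/Lfun1_integrable.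
    exact: Lfun_norm (Lq_L1 f wb).
  by apply: eq_integral => x _ /=; rewrite mul1r.
rewrite -(fineK Nfin) -(finite_norm_fine f) -EFinM lee_fin; exact.
Qed.

(** Integration against [phi] is one of the functionals that define weak
convergence in [L^q]. *)
Lemma weak_cvg_C0 (w : openset R d) (q : R) (hq : 1 < q <= 2)
    (v_ : nat -> Lq w hq) (v : Lq w hq) (phi : C0 w) :
  bounded_set (oset w) -> weak_cvg v_ v ->
  (fun m => \int[leb_on w]_x (v_ m x * phi x)) @ \oo -->
    \int[leb_on w]_x (v x * phi x).
Proof.
move=> wb vv; have [A A0 AL] := L1norm_Lq hq wb.
pose ell (f : Lq w hq) : R^o := \int[leb_on w]_x (f x * phi x).
have ell_lin : linear ell.
  move=> a f g; rewrite /ell -[RHS]/(a * _ + _) -RintegralZl//; last first.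
    by apply: integrable_C0; exact: Lq_L1.
  rewrite -RintegralD//.
  - by apply: eq_Rintegral => x _; rewrite /= mulrDl mulrA.
  - have := integrable_C0 phi (Lq_L1 (a *: f) wb).
    by apply: eq_integrable => // x _ /=; rewrite mulrA.
  - by apply: integrable_C0; exact: Lq_L1.
pose ellM := GRing.isLinear.Build _ _ _ _ ell ell_lin.
pose ellL : {scalar Lq w hq} := HB.pack ell ellM.
apply: (vv ellL); exists (`|phi| * A) => f.
have := @normr_int_mul_le _ _ w phi f `|phi| `|phi|.
rewrite /= /ell; under eq_Rintegral do rewrite mulrC.
move=> H; apply: (le_trans (H _ _ _ _ _)) => //.
- exact: Lq_L1.
- exact: C0_measurable.
- by move=> x; exact: C0_norm_ub.
- by move=> x _; exact: C0_norm_ub.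
- by rewrite -mulrA ler_wpM2l.
Qed.

Lemma ereal_le_above (x y : \bar R) : (0 <= x)%E ->
  (forall c : R, (x < c%:E)%E -> (y <= c%:E)%E) -> (y <= x)%E.
Proof.
case: x => [x| |]// x0 H; last by rewrite leey.
by apply/lee_addgt0Pr => e e0; rewrite -EFinD; apply: H; rewrite lte_fin ltrDl.
Qed.

End main_argument.

Theorem lemma2p7 (R : realType) (d : nat) (Omega Sigma : openset R d)
    (Omega_bounded : bounded_set Omega)
    (Omega_sc : simply_connected Omega)
    (Sigma_bounded : bounded_set Sigma)
    (Sigma_sc : simply_connected Sigma)
    (Sigma0 : oset Sigma 0)
    (net : network) (Nc : nat)
    (Z : {linear weights Sigma net -> 'rV[R]_Nc})
    (Z_bounded : exists C : R, forall th, `|Z th| <= C * weights_norm th)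
    (J : forall i : 'I_(nlayers net).-1, Mlayer Omega Sigma net i.+1 -> \bar R)
    (J_ge0 : forall i mu, (0 <= J i mu)%E)
    (J_lsc : forall i, weakstar_lsc (J i))
    (J0 : forall i, J i (fun=> 0) = 0%E)
    (q : R) (hq : 1 < q <= 2)
    (v_ : nat -> Lq Omega hq) (v : Lq Omega hq) :
  weak_cvg v_ v ->
  (generative_prior Z J v <= limn_einf (fun m => generative_prior Z J (v_ m)))%E.
Proof.
move=> vv; have UL := layer_conv_L2 Omega_bounded Sigma_bounded.
have energy_ge0 mu th : (0 <= energy J mu th)%E.
  rewrite /energy adde_ge0//; last by apply: sume_ge0 => i _; exact: J_ge0.
  by apply: sume_ge0 => l _; apply: sume_ge0 => n _; exact: dual_norm_ge0.
have prior_ge0 f : (0 <= generative_prior Z J f)%E.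
  by apply: le_ereal_inf_tmp => _ [p _ <-].
apply: ereal_le_above.
  apply: le_trans (einfs_le_limn_einf _ 0).
  by apply: le_ereal_inf_tmp => _ [m _ <-].
move=> c cl.
(* Along the indices [s k] the prior stays below [c], with almost optimal
feasible pairs [(mu_ k, th_ k)]. *)
have ex k : exists mp : nat * (measures Omega Sigma net * weights Sigma net),
    [/\ (k <= mp.1)%N, feasible Z (v_ mp.1) mp.2 & (energy J mp.2.1 mp.2.2 < c%:E)%E].
  have [m km] := limn_einf_subseq cl k.
  by move=> /ereal_inf_lt[_ [p pF <-] pc]; exists (m, p).
pose s k := (sval (cid (ex k))).1.
pose mu_ k := (sval (cid (ex k))).2.1; pose th_ k := (sval (cid (ex k))).2.2.
have sk k : (k <= s k)%N by rewrite /s; case: cid => /= ? [].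
have vE k : v_ (s k) = layer_conv (mu_ k (layer1 net)) (th_ k) (unit1 net)
    %[ae leb_on Omega].
  by rewrite /s /mu_ /th_; case: cid => /= ? [_ []].
have th1 k e : Lq_norm Sigma 2 (th_ k e) <= 1.
  by rewrite /th_; case: cid => /= ? [_ []].
have Z0 k : Z (th_ k) = 0 by rewrite /th_; case: cid => /= ? [_ []].
have ek k : (energy J (mu_ k) (th_ k) <= c%:E)%E.
  by apply: ltW; rewrite /mu_ /th_; case: cid => /= ? [].
have mc k : (measures_norm (mu_ k) <= c%:E)%E.
  apply: le_trans (ek k); rewrite leeDl// sume_ge0// => i _; exact: J_ge0.
have [U [UU sU]] := @ultraFilterLemma nat \oo _.
have UP : ProperFilter U by exact: ultra_proper.
have [mu [th [mu_cvg th_cvg th_le1]]] := bounded_family_limit UU mc th1.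
suff pF : feasible Z v (mu, th).
  apply: (@le_trans _ _ (energy J mu th)).
    by apply: ereal_inf_lbound; exists (mu, th).
  exact: (energy_le Omega_bounded Sigma_bounded UU mc th1 mu_cvg th_cvg th_le1).
split => //=; last exact: (weights_lim_eq0 UU th_cvg Z_bounded Z0).
set h := layer_conv _ _ _.
have hL : h \in Lfun (leb_on Omega) 2%:E by exact: UL.
have hL1 := L2_L1 Omega_bounded hL; have vL1 := Lq_L1 v Omega_bounded.
suff : (fun x => v x - h x) = (fun=> 0) %[ae leb_on Omega].
  by apply: filterS => x H _; apply/eqP; rewrite -subr_eq0; apply/eqP; exact: H.
apply: ae0_of_C0 => //.
  exact: (rpredB vL1 hL1).
move=> phi.
have -> : \int[leb_on Omega]_x ((v x - h x) * phi x) =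
    \int[leb_on Omega]_x (v x * phi x) - \int[leb_on Omega]_x (h x * phi x).
  rewrite -RintegralB//; try exact: integrable_C0.
  by apply: eq_Rintegral => x _; rewrite mulrBl.
apply/eqP; rewrite subr_eq0; apply/eqP.
have cv1 := weak_cvg_C0 (phi := phi) Omega_bounded vv.
have cv2 := layer_cvg Omega_bounded Sigma_bounded UU mc th1 mu_cvg th_cvg th_le1
  (l := layer1 net) (k := unit1 net) (phi := phi).
have E k : \int[leb_on Omega]_x
    (layer_conv (mu_ k (layer1 net)) (th_ k) (unit1 net) x * phi x) =
    \int[leb_on Omega]_x (v_ (s k) x * phi x).
  have lL1 := L2_L1 Omega_bounded (UL _ _ (mu_ k (layer1 net)) (th_ k) (unit1 net)).
  congr fine; apply: ae_eq_integral => //.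
  - exact: measurable_int (integrable_C0 phi lL1).
  - exact: measurable_int (integrable_C0 phi (Lq_L1 (v_ (s k)) Omega_bounded)).
  - by apply: filterS (vE k) => x H _ /=; rewrite H.
have ss : s @ \oo --> \oo.
  move=> A [n _ nA]; exists n => // k /= nk; apply: nA => /=.
  exact: leq_trans nk (sk k).
have cv3 : (fun k => \int[leb_on Omega]_x
    (layer_conv (mu_ k (layer1 net)) (th_ k) (unit1 net) x * phi x)) @ U -->
    \int[leb_on Omega]_x (v x * phi x).
  rewrite (funext E); apply: cvg_trans (cvg_comp _ _ ss cv1).
  by apply: cvg_app => A /=; exact: sU.
exact: (@cvg_unique _ (@Rhausdorff R) _ _ _ _ cv3 cv2).
Qed.
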